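(* Let $e \geqslant 3$ be an integer. Then there exists $N$ such that for all integers $n > N$, \[ |\mathcal C_e(\mathsf S_n)| = \begin{cases} 2^{\binom{e-2}{2}}, & \text{if $n$ is even},\\ 2^{\binom{e-2}{2}+1}, & \text{if $n$ is odd}. \end{cases} \]
   Context: For $a\in\mathbb Z$ and a positive integer $e$, $\overline{a}^{(e)}$ denotes the residue class of $a$ modulo $2^e$. $\mathsf S_n$ is the set of symmetric $n\times n$ matrices with all entries in $\{1,-1\}$ and all diagonal entries equal to $1$. For a set $\mathsf M_n$ of $n\times n$ integer matrices, $\mathcal C_e(\mathsf M_n)$ is the set of tuples $\left(\overline{a_2}^{(e)},\dots,\overline{a_e}^{(e)}\right)$ such that $\det(xI-M)=\sum_{i=0}^n a_i x^{n-i}$ for some $M\in\mathsf M_n$ (with $a_i:=0$ for $i>n$). *)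

(* Defs.v *)
From HB Require Import structures.
From mathcomp Require Import all_boot all_order all_algebra.
From mathcomp Require Import boolp classical_sets.

Set Implicit Arguments.
Unset Strict Implicit.
Unset Printing Implicit Defensive.

Import GRing.Theory.
Local Open Scope ring_scope.

Definition symSign1 (n : nat) : set 'M[int]_n :=
  fun M => [/\ forall i j, M i j = M j i,
               forall i j, M i j = 1 \/ M i j = -1
             & forall i, M i i = 1].

(* The a_i of det(xI - M) = \sum_i a_i x^(n - i); the test is needed because
   n - i is truncated at 0. *)
Definition char_coef (n : nat) (M : 'M[int]_n) (i : nat) : int :=
  if (i <= n)%N then (char_poly M)`_(n - i)%N else 0.

(* 'Z_(2 ^ e) is the ring of integers modulo 2 ^ e only for e > 0. *)
Definition char_residues (e n : nat) (M : 'M[int]_n) :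
    (e.-1).-tuple 'Z_(2 ^ e) :=
  [tuple (char_coef M i.+2)%:~R | i < e.-1].

Definition char_classes (e n : nat) (Mn : set 'M[int]_n) :
    {set (e.-1).-tuple 'Z_(2 ^ e)} :=
  finset (fun t => `[< exists2 M, Mn M & char_residues e M = t >]).

(* Main.v *)
Require Import Defs.
From HB Require Import structures.
From mathcomp Require Import all_boot all_order all_algebra.
From mathcomp Require Import boolp classical_sets.
From mathcomp Require Import perm zify ring.

(** Write a symmetric sign matrix as [M = J - 2 A] with [A] the adjacency matrix of
    a graph, and put [C = det (1 + y A)], [V = 1^T adj(1 + y A) 1].  Then
    [det (1 - x M) = C (2 x) - x V (2 x)], so [a_i = 2^(i-1) b_i] with
    [b_i = 2 c_i - v_(i-1)].

    Upper bound.  Adding vertices one at a time gives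
    [C(y)^2 = (n + 1) C(y^2) - V(y^2) mod 4].  Hence [v_k = n c_k mod 2], and the odd
    coefficients of [C] are even.  For even [n] all [b_i] are even.  For odd [n],
    [b_(k+1) = c_k mod 2], and the congruence at [y^(2k)] expresses [c_(2k) mod 2]
    through [b_(k+1) mod 4] and the [c_j mod 2] with [j < 2k]; so [b_i mod 2] is
    determined by the earlier [b_j mod 4] for all [i > 3].  Finally [a_2 = 0].

    Lower bound.  Disjoint union multiplies [C + eps V] in the dual numbers.  Replacing
    two paths on [i - 1] vertices by paths on [i] and [i - 2] vertices changes [b_i] by
    2 up to sign and no earlier [b_j], so suitably many such replacements separate all
    the admissible tuples.  For odd [n], joining two isolated vertices by an edge
    changes the parity of [b_3]. *)

Set Implicit Arguments.
Unset Strict Implicit.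
Unset Printing Implicit Defensive.

Import Order.TTheory GRing.Theory Num.Theory.
Local Open Scope ring_scope.

(** * Adjugates of bordered matrices *)

Section Bordering.
Variable R : idomainType.

Definition quadf k (u : 'rV[R]_k) (D : 'M[R]_k) (w : 'cV[R]_k) : R :=
  (u *m \adj D *m w) 0 0.

Notation ones k := (const_mx 1 : 'cV[R]_k).

Definition ones_adj_sum k (D : 'M[R]_k) : R := quadf (const_mx 1) D (const_mx 1).

Lemma mx11_0 (A B : 'M[R]_1) : A 0 0 = B 0 0 -> A = B.
Proof. by move=> h; rewrite [A]mx11_scalar [B]mx11_scalar h. Qed.

(** Multiplying on the right by a block lower triangular matrix of determinant [\det D] clears the
    column [w]; the extra factor [\det D] then cancels. *)
Lemma det_border k (a : R) (u : 'rV[R]_k) w (D : 'M[R]_k) : \det D != 0 ->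
  \det (block_mx (a%:M : 'M_1) u w D) = a * \det D - quadf u D w.
Proof.
move=> D0; apply: (mulIf D0).
have <- : \det (block_mx ((\det D)%:M : 'M_1) 0 (- (\adj D *m w)) 1%:M) = \det D.
  by rewrite det_lblock det1 mulr1 det_scalar1.
rewrite -det_mulmx mulmx_block !mulmx1 !mulmx0 !add0r !mulmxN !mulmxA mul_mx_adj.
rewrite [w *m _]mul_mx_scalar [(_ %:M) *m w]mul_scalar_mx subrr det_ublock -scalar_mxM.
rewrite det_lblock det_scalar1 det1 mulr1; congr (_ * _).
by rewrite det_mx11 mxE [in RHS]/quadf; congr (_ + _); rewrite mxE ?mulr1n.
Qed.

(** The matrix [D] bordered by a row of [- t], a column of 1 and the corner 1 has its determinant
    computed twice: by [det_border], and by eliminating the column, which turns [D] into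
    [D + const_mx t]. *)
Lemma det_addJ k (D : 'M[R]_k) (t : R) : \det D != 0 ->
  \det (D + const_mx t) = \det D + t * ones_adj_sum D.
Proof.
move=> D0.
have := @det_border k 1 (const_mx (- t)) (const_mx 1) D D0.
have -> : block_mx (1%:M : 'M_1) (const_mx (- t)) (const_mx 1) D =
  block_mx (1%:M : 'M_1) 0 (const_mx 1) 1%:M *m
  block_mx (1%:M : 'M_1) (const_mx (- t)) 0 (D + const_mx t).
  rewrite mulmx_block !mul1mx !mul0mx ?mulmx1 !addr0; congr block_mx.
  rewrite addrCA -[LHS]addr0; congr (_ + _).
  by apply/matrixP=> i j; rewrite !mxE big_ord1 !mxE; ring.
rewrite det_mulmx det_lblock det_ublock !det1 !mul1r => ->; congr (_ + _).
rewrite /ones_adj_sum /quadf.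
have -> : const_mx (- t) = - t *: (const_mx 1 : 'rV[R]_k).
  by apply/matrixP=> i j; rewrite !mxE mulr1.
by rewrite -!scalemxAl mxE mulNr opprK.
Qed.

(** Cramer's rule read backwards: to identify [\adj D *m b] it suffices to guess the product and
    multiply the guess by [D], without computing cofactors. *)
Lemma adj_solve k (D : 'M[R]_k) m (s b : 'M[R]_(k, m)) : \det D != 0 ->
  D *m s = \det D *: b -> s = \adj D *m b.
Proof.
move=> D0 /(congr1 (mulmx (\adj D))).
rewrite mulmxA mul_adj_mx mul_scalar_mx -scalemxAr => h.
apply/matrixP=> i j; apply: (mulfI D0).
by move/matrixP: h => /(_ i j); rewrite !mxE.
Qed.

Lemma det_dsum k l (D : 'M[R]_k) (E : 'M[R]_l) :
  \det (block_mx D 0 0 E) = \det D * \det E.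
Proof. exact: det_lblock. Qed.

Lemma ones_adj_sum_dsum k l (D : 'M[R]_k) (E : 'M[R]_l) : \det D != 0 -> \det E != 0 ->
  ones_adj_sum (block_mx D 0 0 E) = ones_adj_sum D * \det E + \det D * ones_adj_sum E.
Proof.
move=> D0 E0; rewrite /ones_adj_sum /quadf.
have DE0 : \det (block_mx D 0 0 E) != 0 by rewrite det_dsum mulf_neq0.
have S : col_mx (\det E *: (\adj D *m ones k)) (\det D *: (\adj E *m ones l)) =
    \adj (block_mx D 0 0 E) *m ones (k + l).
  apply: adj_solve => //; rewrite mul_block_col !mul0mx addr0 add0r.
  rewrite -!scalemxAr !mulmxA !mul_mx_adj !mul_scalar_mx !scalerA det_dsum.
  by rewrite mulrC -scale_col_mx col_mx_const.
rewrite -!mulmxA -S -row_mx_const mul_row_col mxE -!scalemxAr !mxE.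
by rewrite mulrC.
Qed.

Section SymBorder.
Variables (k : nat) (D : 'M[R]_k) (u : 'rV[R]_k).
Hypotheses (D0 : \det D != 0) (Dsym : D^T = D).
Let D' := block_mx (1%:M : 'M_1) u u^T D.
Hypothesis D'0 : \det D' != 0.
Let r := \det D - quadf u D (const_mx 1).

Lemma quadf_sym (v w : 'rV[R]_k) : quadf v D w^T = quadf w D v^T.
Proof.
rewrite /quadf; have tr11 (A : 'M[R]_1) : A 0 0 = A^T 0 0 by rewrite mxE.
by rewrite [LHS]tr11 !trmx_mul trmxK trmx_adj Dsym mulmxA.
Qed.

Lemma det_symborder : \det D' = \det D - quadf u D u^T.
Proof. by rewrite det_border // mul1r. Qed.

(* The left side is the solution of [D' s = \det D *: (\det D' *: 1)] given by block
   elimination, cleared of denominators. *)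
Lemma adj_border_ones :
  col_mx (r * \det D)%:M (\adj D *m (\det D' *: ones k - r *: u^T)) =
  \det D *: (\adj D' *m ones (1 + k)).
Proof.
rewrite scalemxAr; apply: adj_solve => //.
rewrite mul_block_col mul1mx -col_mx_const !scale_col_mx; congr col_mx.
  rewrite mulmxA mulmxDr mulmxN -!scalemxAr.
  apply: mx11_0.
  have e1 : (u *m \adj D *m ones k) 0 0 = \det D - r.
    by rewrite /r /quadf; ring.
  have e2 : (u *m \adj D *m u^T) 0 0 = \det D - \det D'.
    by rewrite det_symborder /quadf; ring.
  by rewrite !mxE mulr1n; move: e1 e2; rewrite !mxE => -> ->; ring.
rewrite mulmxA mul_mx_adj mul_scalar_mx mul_mx_scalar scalerBr !scalerA.
by rewrite [\det D * r]mulrC [\det D * _]mulrC addrC subrK.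
Qed.

(** The entries of the solution in [adj_border_ones] are added up. Symmetry of [D] replaces the
    pairing of ones with [u^T] by [\det D - r], and this produces the square of [r]. *)
Lemma ones_adj_sum_border : ones_adj_sum D' * \det D = ones_adj_sum D * \det D' + r ^+ 2.
Proof.
have S := adj_border_ones.
have -> : ones_adj_sum D' * \det D =
   ((const_mx 1 : 'rV[R]_(1 + k)) *m (\det D *: (\adj D' *m ones (1 + k)))) 0 0.
  by rewrite -scalemxAr mxE mulrC mulmxA.
rewrite -S -row_mx_const mul_row_col.
have -> : (const_mx 1 : 'M[R]_1) = 1%:M.
  by apply: mx11_0; rewrite !mxE.
rewrite mul1mx mulmxA mulmxDr mulmxN -!scalemxAr.
have e1 : ((const_mx 1 : 'rV[R]_k) *m \adj D *m u^T) 0 0 = \det D - r.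
  rewrite -/(quadf _ _ _) quadf_sym trmx_const /r; ring.
have e2 : ((const_mx 1 : 'rV[R]_k) *m \adj D *m ones k) 0 0 = ones_adj_sum D by [].
by rewrite mxE [in X in _ + X]mxE [in X in _ + (_ + X)]mxE
  [in X in _ + (X + _)]mxE [in X in _ + (_ - X)]mxE e1 e2 !mxE mulr1n; ring.
Qed.

Let e0 : 'rV[R]_(1 + k) := \row_j ((j : nat) == 0%N)%:R.

Lemma root_row_blockE : e0 = row_mx 1%:M 0.
Proof.
apply/matrixP=> i j; rewrite !mxE; case: splitP => l jl; rewrite jl !mxE ?ord1 //.
Qed.

(** This is the top entry of the solution in [adj_border_ones]. It gives the recursion along a path,
    where the next border row is supported on the newest vertex. *)
Lemma quadf_root_ones : quadf e0 D' (ones (1 + k)) = r.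
Proof.
apply: (mulfI D0).
have -> : \det D * quadf e0 D' (ones (1 + k)) =
   (e0 *m (\det D *: (\adj D' *m ones (1 + k)))) 0 0.
  by rewrite -scalemxAr mxE mulmxA.
rewrite -adj_border_ones root_row_blockE mul_row_col mul1mx mul0mx addr0 !mxE.
by rewrite mulr1n mulrC.
Qed.

Lemma quadf_root : quadf e0 D' e0^T = \det D.
Proof.
have S : col_mx (\det D)%:M (- (\adj D *m u^T)) = \adj D' *m e0^T.
  apply: adj_solve => //.
  rewrite mul_block_col mul1mx root_row_blockE tr_row_mx trmx0 tr_scalar_mx scale_col_mx scaler0.
  congr col_mx.
    apply: mx11_0; rewrite det_symborder /quadf mulmxN mulmxA.
    by rewrite mxE [in X in _ + X]mxE [in RHS]mxE !mxE mulr1n mulr1.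
  by rewrite mulmxN mulmxA mul_mx_adj mul_scalar_mx mul_mx_scalar subrr.
by rewrite /quadf -mulmxA -S root_row_blockE mul_row_col mul1mx mul0mx addr0 mxE mulr1n.
Qed.

End SymBorder.
End Bordering.

(** * The polynomials C and V of a graph *)

Section Adjacency.

Definition adjacency n (A : 'M[int]_n) : Prop :=
  [/\ forall i j, A i j = A j i, forall i, A i i = 0
    & forall i j, A i j = 0 \/ A i j = 1].

Definition pencil n (A : 'M[int]_n) : 'M[{poly int}]_n :=
  1%:M + 'X *: map_mx polyC A.

Definition pdet n (A : 'M[int]_n) : {poly int} := \det (pencil A).
Definition psum n (A : 'M[int]_n) : {poly int} := ones_adj_sum (pencil A).

(** At 0 the pencil is the identity. The constant coefficient 1 makes [pdet A] nonzero and
    cancellable in congruences. *)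
Lemma coef0_pdet n (A : 'M[int]_n) : (pdet A)`_0 = 1.
Proof.
rewrite -horner_coef0 -/(horner_eval 0 (pdet A)) /pdet -det_map_mx.
suff -> : map_mx (horner_eval 0) (pencil A) = 1%:M by rewrite det1.
apply/matrixP=> i j; rewrite !mxE /horner_eval hornerD hornerM hornerX mul0r addr0.
by case: (i == j); rewrite hornerE.
Qed.

Lemma pdet_neq0 n (A : 'M[int]_n) : pdet A != 0.
Proof. by apply/eqP=> h; have := coef0_pdet A; rewrite h coef0. Qed.

Lemma tr_pencil n (A : 'M[int]_n) : (forall i j, A i j = A j i) -> (pencil A)^T = pencil A.
Proof. by move=> As; apply/matrixP=> i j; rewrite !mxE eq_sym As. Qed.

Lemma pencil_block n m (A : 'M[int]_n) (B : 'M[int]_m) U L :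
  pencil (block_mx A U L B) =
  block_mx (pencil A) ('X *: map_mx polyC U) ('X *: map_mx polyC L) (pencil B).
Proof.
by rewrite /pencil map_block_mx scale_block_mx scalar_mx_block add_block_mx !add0r.
Qed.

Lemma pencil_border n (A : 'M[int]_n) (u : 'rV[int]_n) :
  pencil (block_mx (0 : 'M_1) u u^T A) =
  block_mx (1%:M : 'M_1) ('X *: map_mx polyC u) ('X *: map_mx polyC u)^T (pencil A).
Proof.
rewrite pencil_block; congr block_mx.
  by apply/matrixP=> i j; rewrite !mxE mulr0 addr0.
by apply/matrixP=> i j; rewrite !mxE.
Qed.

Lemma adjacency_border n (A : 'M[int]_(1 + n)) : adjacency A ->
  exists u, exists2 B : 'M[int]_n, A = block_mx (0 : 'M_1) u u^T B &
   adjacency B /\ (forall j, u 0 j = 0 \/ u 0 j = 1).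
Proof.
case=> As A0 A01; exists (ursubmx A); exists (drsubmx A).
  rewrite -[LHS]submxK; congr block_mx.
    by apply/matrixP=> i j; rewrite !ord1 !mxE A0.
  by apply/matrixP=> i j; rewrite !ord1 !mxE As.
split; first by split=> [i j|i|i j]; rewrite !mxE.
by move=> j; rewrite !mxE.
Qed.

Lemma adjacency_of_border n (B : 'M[int]_n) (u : 'rV[int]_n) :
  adjacency B -> (forall j, u 0 j = 0 \/ u 0 j = 1) ->
  adjacency (block_mx (0 : 'M_1) u u^T B).
Proof.
case=> Bs B0 B01 u01; pose E := (block_mxEul, block_mxEur, block_mxEdl, block_mxEdr).
split=> [i j|i|i j].
- case: (split_ordP i) => k ->; case: (split_ordP j) => l ->; by rewrite !E ?mxE.
- by case: (split_ordP i) => k ->; rewrite !E ?mxE.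
- case: (split_ordP i) => k ->; case: (split_ordP j) => l ->; rewrite !E ?mxE ?ord1 //.
  by left.
Qed.

Lemma adjacency_dsum n m (A : 'M[int]_n) (B : 'M[int]_m) :
  adjacency A -> adjacency B -> adjacency (block_mx A 0 0 B).
Proof.
case=> As A0 A01 [Bs B0 B01]; pose E := (block_mxEul, block_mxEur, block_mxEdl, block_mxEdr).
split=> [i j|i|i j].
- case: (split_ordP i) => k ->; case: (split_ordP j) => l ->; by rewrite !E ?mxE.
- by case: (split_ordP i) => k ->; rewrite !E ?mxE.
- case: (split_ordP i) => k ->; case: (split_ordP j) => l ->; rewrite !E ?mxE //; by left.
Qed.

Lemma pdet_dsum n m (A : 'M[int]_n) (B : 'M[int]_m) :
  pdet (block_mx A 0 0 B) = pdet A * pdet B.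
Proof. by rewrite /pdet pencil_block !map_mx0 !scaler0 det_dsum. Qed.

Lemma psum_dsum n m (A : 'M[int]_n) (B : 'M[int]_m) :
  psum (block_mx A 0 0 B) = psum A * pdet B + pdet A * psum B.
Proof. by rewrite /psum pencil_block !map_mx0 !scaler0 ones_adj_sum_dsum // pdet_neq0. Qed.

Lemma even_form (R : comNzRingType) n (B L : 'M[R]_n) (w : 'rV[R]_n) :
  B = L + L^T -> (w *m B *m w^T) 0 0 = 2%:R * (w *m L *m w^T) 0 0.
Proof.
move=> ->; rewrite mulmxDr mulmxDl mxE.
have -> : (w *m L^T *m w^T) 0 0 = (w *m L *m w^T)^T 0 0.
  by rewrite !trmx_mul trmxK mulmxA.
by rewrite [_^T _ _]mxE mulr2n mulrDl mul1r.
Qed.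

Section Border.
Variables (n : nat) (A : 'M[int]_n) (u : 'rV[int]_n).
Hypotheses (As : forall i j, A i j = A j i) (A0 : forall i, A i i = 0).
Let U := map_mx polyC u.
Let c := pdet A.
Let s := quadf U (pencil A) U^T.
Let t := quadf U (pencil A) (const_mx 1).
Let A' := block_mx (0 : 'M_1) u u^T A.

Lemma quadf_scale k (y : {poly int}) (v : 'rV[{poly int}]_k) D w :
  quadf (y *: v) D w = y * quadf v D w.
Proof. by rewrite /quadf -!scalemxAl mxE. Qed.

Lemma quadf_scaler k (y : {poly int}) (v : 'rV[{poly int}]_k) D w :
  quadf v D (y *: w) = y * quadf v D w.
Proof. by rewrite /quadf -!scalemxAr mxE. Qed.

Lemma pdet_border : pdet A' = c - 'X ^+ 2 * s.
Proof.
rewrite /pdet pencil_border det_symborder ?pdet_neq0 //.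
by rewrite linearZ /= quadf_scale quadf_scaler mulrA.
Qed.

Lemma psum_border : psum A' * c = psum A * pdet A' + (c - 'X * t) ^+ 2.
Proof.
rewrite /psum /pdet pencil_border ones_adj_sum_border ?pdet_neq0 ?tr_pencil //.
  by rewrite quadf_scale.
by rewrite -pencil_border pdet_neq0.
Qed.

Let w := U *m \adj (pencil A).

Lemma border_solve : w *m pencil A = c *: U.
Proof. by rewrite /w -mulmxA mul_adj_mx mul_mx_scalar. Qed.

(** One step of the Neumann expansion of [(1 + y A)^-1], cleared of the denominator [c]; it isolates
    the lowest terms of [s] and [t]. *)
Lemma border_adjE : w = c *: U - 'X *: (w *m map_mx polyC A).
Proof.
by rewrite -border_solve /pencil mulmxDr mulmx1 -scalemxAr addrK.
Qed.

Lemma border_rr_low : exists q, s = (\sum_j (u 0 j) ^+ 2)%:P * c + 'X * q.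
Proof.
rewrite /s /quadf -/w border_adjE; eexists.
rewrite mulmxBl -!scalemxAl mxE [in X in _ + X]mxE [in X in _ - X]mxE -mulrN.
congr (_ + 'X * _).
rewrite mxE mulrC; congr (_ * _); rewrite mxE rmorph_sum; apply: eq_bigr => j _.
by rewrite !mxE rmorphXn /= expr2.
Qed.

Lemma border_rt_low : exists q, t = (\sum_j u 0 j)%:P * c + 'X * q.
Proof.
rewrite /t /quadf -/w border_adjE; eexists.
rewrite mulmxBl -!scalemxAl mxE [in X in _ + X]mxE [in X in _ - X]mxE -mulrN.
congr (_ + 'X * _).
rewrite mxE mulrC; congr (_ * _); rewrite mxE rmorph_sum; apply: eq_bigr => j _.
by rewrite !mxE mulr1.
Qed.

(* With [w = u adj(D)], the difference is [w (J + 1 + y A) w^T] up to multiples of 2,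
   and [J + 1 + y A] is symmetric with even diagonal. *)
Lemma border_sqr : exists q, (c - 'X * t) ^+ 2 = pdet A' * c + 2%:R * q.
Proof.
pose B := const_mx 1 + 1%:M + 'X *: map_mx polyC A : 'M[{poly int}]_n.
pose L : 'M[{poly int}]_n := \matrix_(i, j)
  (if (i < j)%N then 1 + 'X * (A i j)%:P else (i == j)%:R).
have BL : B = L + L^T.
  apply/matrixP=> i j; rewrite !mxE (eq_sym j i) (As j i).
  case: ltngtP=> ij.
  - by rewrite (_ : (i == j) = false) ?addr0 //; apply/eqP=> h; rewrite h ltnn in ij.
  - by rewrite (_ : (i == j) = false) ?addr0 ?add0r //; apply/eqP=> h; rewrite h ltnn in ij.
  - by rewrite (ord_inj ij) A0 eqxx mulr0 addr0.
have wB := even_form w BL.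
have e1 : s * c = (w *m pencil A *m w^T) 0 0.
  rewrite border_solve /s -scalemxAl mxE mulrC; congr (_ * _).
  by rewrite quadf_sym ?tr_pencil // /w trmx_mul trmx_adj tr_pencil // mulmxA.
have e2 : t ^+ 2 = (w *m const_mx 1 *m w^T) 0 0.
  have -> : (const_mx 1 : 'M[{poly int}]_n) = (const_mx 1 : 'cV_n) *m (const_mx 1 : 'rV_n).
    by apply/matrixP=> i j; rewrite !mxE big_ord1 !mxE mulr1.
  rewrite !mulmxA -mulmxA mxE big_ord1 expr2; congr (_ * _).
  rewrite /t /quadf -/w.
  have tr11 (X : 'M[{poly int}]_1) : X 0 0 = X^T 0 0 by rewrite mxE.
  by rewrite [LHS]tr11 trmx_mul trmx_const.
have e3 : t ^+ 2 + s * c = 2%:R * (w *m L *m w^T) 0 0.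
  rewrite -wB e1 e2 (_ : B = const_mx 1 + pencil A); last by rewrite /B -addrA.
  by rewrite [in RHS]mulmxDr [in RHS]mulmxDl [in RHS]mxE.
exists ('X ^+ 2 * (w *m L *m w^T) 0 0 - 'X * t * c).
rewrite pdet_border mulrBr.
have -> : 2%:R * ('X ^+ 2 * (w *m L *m w^T) 0 0) = 'X ^+ 2 * (t ^+ 2 + s * c).
  by rewrite e3; ring.
ring.
Qed.

End Border.
End Adjacency.

(** * The congruence modulo 4 for the square of [pdet] *)

Section KeyCongruence.
Implicit Types p q : {poly int}.

Lemma poly_dvd_natP (m : nat) p : (0 < m)%N ->
  (forall j, (m%:Z %| p`_j)%Z) -> exists q, p = m%:R * q.
Proof.
move=> m0 h; exists (\poly_(j < size p) (p`_j %/ m%:Z)%Z).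
apply/polyP=> j; rewrite mulr_natl coefMn coef_poly.
case: ltnP => hj; last by rewrite nth_default // mul0rn.
by rewrite -mulr_natr natz divzK.
Qed.

Lemma unit_const_cancel (m : nat) p q r : (0 < m)%N -> p`_0 = 1 ->
  p * q = m%:R * r -> exists q', q = m%:R * q'.
Proof.
move=> m0 p0 e; apply: poly_dvd_natP => // j.
elim/ltn_ind: j => j IH.
have := congr1 (fun t : {poly int} => t`_j) e.
rewrite mulr_natl coefMn coefM big_ord_recl p0 mul1r subn0 /=.
move/(canRL (addrK _)) => ->; apply: rpredB.
  by rewrite -mulr_natr natz dvdz_mull.
by apply: rpred_sum => i _; rewrite dvdz_mull // IH // /bump /=; have := ltn_ord i; lia.
Qed.

Lemma frobenius_poly p : exists q, p \Po 'X^2 = p ^+ 2 + 2%:R * q.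
Proof.
elim/poly_ind: p => [|p c [q IH]]; first by exists 0; rewrite comp_poly0 expr0n /= mulr0 addr0.
have [d hd] : exists d : int, c ^+ 2 = c + 2%:R * d.
  have [k [->|->]] : exists k : int, c = 2%:R * k \/ c = 2%:R * k + 1.
  - by exists (c %/ 2)%Z; lia.
  - by exists (2%:R * k ^+ 2 - k); ring.
  - by exists (2%:R * k ^+ 2 + k); ring.
rewrite comp_poly_MXaddC IH.
exists (q * 'X^2 - p * 'X * c%:P - d%:P).
have hP : c%:P = c%:P ^+ 2 - 2%:R * d%:P :> {poly int}.
  by rewrite -rmorphXn hd rmorphD rmorphM rmorph_nat /= addrK.
by rewrite [X in _ + X = _]hP; ring.
Qed.

Lemma pdet_mx00 (A : 'M[int]_0) : pdet A = 1.
Proof. by rewrite /pdet det_mx00. Qed.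

Lemma psum_mx00 (A : 'M[int]_0) : psum A = 0.
Proof. by rewrite /psum /ones_adj_sum /quadf mxE big_ord0. Qed.

(** Induction on the number of vertices, with [c], [v] before and [C], [V] after adding one. Modulo
    2, [r ^+ 2] is [C * c], so [r \Po 'X^2] is known modulo 2 and its square modulo 4. *)
Lemma pdet_sqr_mod4 n (A : 'M[int]_n) : adjacency A ->
  exists q, pdet A ^+ 2 =
    n.+1%:R * (pdet A \Po 'X^2) - (psum A \Po 'X^2) + 4%:R * q.
Proof.
elim: n A => [|n IH] A hA.
  by exists 0; rewrite pdet_mx00 psum_mx00 comp_poly0 -[1 in RHS]polyC1 comp_polyC; ring.
have [u [B eA [hB u01]]] := adjacency_border hA.
have [As A0 _] := hB.
rewrite (eA : A = _) {hA eA}.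
have [q1 h1] := border_sqr u As A0.
have h2 := psum_border u As.
have [q3 h3] := IH B hB.
set C := pdet (block_mx _ _ _ _) in h1 h2 *; set V := psum (block_mx _ _ _ _) in h2 *.
set r := _ - 'X * _ in h1 h2.
set c := pdet B in h1 h2 h3; set v := psum B in h2 h3.
have [q4 h4] := frobenius_poly r.
have [q5 h5] := frobenius_poly C.
have [q6 h6] := frobenius_poly c.
have h2' : (V \Po 'X^2) * (c \Po 'X^2) =
  (v \Po 'X^2) * (C \Po 'X^2) + (r \Po 'X^2) ^+ 2.
  by rewrite -comp_polyM h2 comp_polyD comp_polyM rmorphXn.
have c0 : (c \Po 'X^2)`_0 = 1.
  by rewrite coef_comp_poly_Xn // dvdn0 div0n coef0_pdet.
pose K := C ^+ 2 - n.+2%:R * (C \Po 'X^2) + (V \Po 'X^2).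
(* [psum_border] determines [V] only after multiplication by [c], hence the factor [c \Po 'X^2]; its
   constant coefficient 1 lets it be cancelled. *)
suff [q hq] : exists q, (c \Po 'X^2) * K = 4%:R * q.
  have [q' hq'] := @unit_const_cancel 4 _ _ _ isT c0 hq.
  by exists q'; rewrite -hq' /K; ring.
have -> : (c \Po 'X^2) * K = (C ^+ 2 - n.+2%:R * (C \Po 'X^2)) * (c \Po 'X^2)
   + ((v \Po 'X^2) * (C \Po 'X^2) + (r \Po 'X^2) ^+ 2).
  by rewrite /K -h2'; ring.
have hv : v \Po 'X^2 = n.+1%:R * (c \Po 'X^2) + 4%:R * q3 - c ^+ 2.
  by rewrite h3; ring.
have hr : r \Po 'X^2 = C * c + 2%:R * (q1 + q4) by rewrite h4 h1; ring.
rewrite hv hr h5 h6.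
(* Modulo 4 the expression is the product of [C ^+ 2 - (C \Po 'X^2)] and [c ^+ 2 + (c \Po 'X^2)],
   both even by [frobenius_poly]. *)
exists (q3 * (C ^+ 2 + 2%:R * q5) + C * c * (q1 + q4) + (q1 + q4) ^+ 2
  - q5 * c ^+ 2 - q5 * q6).
by rewrite -[n.+2]addn1 natrD; ring.
Qed.

(** The induction builds [a] as minus the number of edges. The same [a] occurs in both expansions,
    which is why the second coefficient of the characteristic polynomial vanishes. *)
Lemma low_coefs n (A : 'M[int]_n) : adjacency A ->
  exists a p q, pdet A = 1 + 'X^2 * (a + 'X * p) /\
                psum A = n%:R + 2%:R * a * 'X + 'X^2 * q.
Proof.
elim: n A => [|n IH] A hA.
  by exists 0, 0, 0; rewrite pdet_mx00 psum_mx00; split; ring.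
have [u [B eA [hB u01]]] := adjacency_border hA.
have [As A0 _] := hB.
rewrite (eA : A = _) {hA eA}.
have [s hs] := border_rr_low B u; have [t ht] := border_rt_low B u.
have hC := pdet_border B u; have hV := psum_border u As.
have e2 : \sum_j u 0 j ^+ 2 = \sum_j u 0 j.
  by apply: eq_bigr => j _; case: (u01 j) => ->; rewrite ?expr0n ?expr1n.
rewrite hs e2 in hC; rewrite ht in hV; move: hC hV.
have [a [p [q [-> ->]]]] := IH B hB.
set S := (\sum_j u 0 j)%:P.
set C := pdet (block_mx _ _ _ _); set V := psum (block_mx _ _ _ _).
set c := 1 + _ => hC hV.
pose P := a + 'X * p; pose Z := P - S * 'X * P - t.
(* [S] is the degree of the new vertex. The squared term of [psum_border] is that of
   [1 - 'X * S + 'X^2 * Z]; since [c = 1 + 'X^2 * P], replacing [V * c] by [V] costs only [V * P] in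
   the last witness. *)
exists (a - S), (p - S * 'X * P - s),
  (q + (n%:R + 2%:R * a * 'X + 'X^2 * q) * (P - S * c - 'X * s)
   + S ^+ 2 + 2%:R * (1 - 'X * S) * Z + 'X^2 * Z ^+ 2 - V * P); split.
  by rewrite hC /c /P; ring.
have -> : V = V * c - V * ('X^2 * P) by rewrite /c /P; ring.
by rewrite {1}hV hC -[n.+1]addn1 natrD /Z /P /c; ring.
Qed.

End KeyCongruence.

(** * Coefficients of the characteristic polynomial *)

Section CharCoef.

(** [p] and [q] are reversals of each other in formal degree [n]. The size bounds make the
    coefficients beyond [n] vanish when a linear factor is multiplied in. *)
Definition reciprocal n (p q : {poly int}) : Prop :=
  [/\ (size p <= n.+1)%N, (size q <= n.+1)%N
    & forall k, (k <= n)%N -> p`_(n - k) = q`_k].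

Lemma reciprocal_linear n (p q : {poly int}) (a b : int) : reciprocal n p q ->
  reciprocal n.+1 ((a%:P * 'X + b%:P) * p) ((a%:P + b%:P * 'X) * q).
Proof.
case=> sp sq h; split.
- apply: leq_trans (size_polyMleq _ _) _.
  have h2 : (size (a%:P * 'X + b%:P)%R <= 2)%N.
    by rewrite size_MXaddC; case: ifP => // _; rewrite ltnS size_polyC_leq1.
  by rewrite -subn1 leq_subLR; apply: leq_trans (leq_add h2 sp) _.
- apply: leq_trans (size_polyMleq _ _) _; rewrite addrC.
  have h2 : (size (b%:P * 'X + a%:P)%R <= 2)%N.
    by rewrite size_MXaddC; case: ifP => // _; rewrite ltnS size_polyC_leq1.
  by rewrite -subn1 leq_subLR; apply: leq_trans (leq_add h2 sq) _.
move=> k hk; rewrite !mulrDl -!mulrA !coefD !coefCM !coefXM.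
case: k hk => [|k] hk; last rewrite subSS.
  by rewrite subn0 /= (nth_default _ sp) !mulr0 -(h 0%N) ?subn0.
rewrite /= h //; congr (_ + _).
case: (leqP k.+1 n) => hkn; last first.
  by have -> : k = n; [lia | rewrite subnn (nth_default _ sq)].
rewrite (_ : (n - k == 0)%N = false); last by apply/eqP; lia.
by rewrite -h // (_ : (n - k).-1 = n - k.+1)%N //; lia.
Qed.

Lemma reciprocal_prod n (a b : 'I_n -> int) :
  reciprocal n (\prod_(i < n) ((a i)%:P * 'X + (b i)%:P))
               (\prod_(i < n) ((a i)%:P + (b i)%:P * 'X)).
Proof.
elim: n a b => [|n IH] a b; last by rewrite !big_ord_recl; apply: reciprocal_linear.
rewrite !big_ord0; split; rewrite ?size_poly1 // => k hk.
by rewrite (_ : k = 0%N) //; lia.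
Qed.

(** In the Leibniz formula each permutation contributes, on the two sides, products of linear
    factors that are reversals of each other. *)
Lemma coef_char_poly_rev n (M : 'M[int]_n) k : (k <= n)%N ->
  (char_poly M)`_(n - k) = (\det (1%:M - 'X *: map_mx polyC M))`_k.
Proof.
move=> hk; rewrite /char_poly /determinant !coef_sum; apply: eq_bigr => s _.
pose a (i : 'I_n) : int := (i == s i)%:R; pose b i := - M i (s i).
have [_ _ /(_ k hk)] := reciprocal_prod a b.
rewrite !mulr_sign.
have -> : \prod_(i < n) ((a i)%:P * 'X + (b i)%:P) =
          \prod_i char_poly_mx M i (s i).
  apply: eq_bigr => i _; rewrite !mxE /a /b rmorphN; congr (_ - _).
  by case: (i == s i); rewrite /= ?mul1r ?mul0r.
have -> : \prod_(i < n) ((a i)%:P + (b i)%:P * 'X) =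
          \prod_i (1%:M - 'X *: map_mx polyC M) i (s i).
  apply: eq_bigr => i _; rewrite !mxE /a /b rmorphN mulNr [_ * 'X]mulrC; congr (_ - _).
  by case: (i == s i).
by case: (s : bool) => h; rewrite ?coefN h.
Qed.

Lemma coef_comp_scaleX (p : {poly int}) (c : int) k :
  (p \Po (c *: 'X))`_k = c ^+ k * p`_k.
Proof.
elim/poly_ind: p k => [|p d IH] k; first by rewrite comp_poly0 !coef0 mulr0.
rewrite comp_poly_MXaddC -scalerAr !coefD coefZ !coefMX !coefC.
case: k => [|k] /=; first by rewrite mulr0 expr0 mul1r.
by rewrite IH !addr0 exprS mulrA.
Qed.

(** With [M = J - 2 A], the matrix [1 - y M] is the pencil of [A] at [2 y] minus [y J], so
    [det_addJ] applies. *)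
Lemma char_coefE n (A : 'M[int]_n) k : (k < n)%N ->
  char_coef (const_mx 1 - 2%:R *: A) k.+1 =
  2%:R ^+ k * (2%:R * (pdet A)`_k.+1 - (psum A)`_k).
Proof.
move=> hk; rewrite /char_coef hk coef_char_poly_rev //.
pose f : {rmorphism {poly int} -> {poly int}} := comp_poly ((2%:R : int) *: 'X).
pose D := map_mx f (pencil A).
have dD : \det D = f (pdet A) by rewrite det_map_mx.
have D0 : \det D != 0.
  apply/eqP=> h; have := coef_comp_scaleX (pdet A) 2%:R 0.
  by rewrite (_ : _ \Po _ = f (pdet A)) // -dD h coef0 coef0_pdet.
have oD : ones_adj_sum D = f (psum A).
  rewrite /psum /ones_adj_sum /quadf; set Q := _ *m \adj (pencil A) *m _.
  have -> : f (Q 0 0) = map_mx f Q 0 0 by rewrite [RHS]mxE.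
  by rewrite !map_mxM !map_const_mx rmorph1 map_mx_adj.
have -> : 1%:M - 'X *: map_mx polyC (const_mx 1 - 2%:R *: A) = D + const_mx (- 'X).
  apply/matrixP=> i j; rewrite !mxE [f _]rmorphD [f (_ * _)]rmorphM /= rmorph_nat.
  rewrite comp_polyX comp_polyC polyCB polyCM polyC1 -mul_polyC polyC_natr.
  ring.
rewrite det_addJ // dD oD coefD mulNr coefN coefXM /= !coef_comp_scaleX exprS; ring.
Qed.

End CharCoef.

(** * Parity of the coefficients *)

Section Parity.

Lemma sum_sym_even (F : nat -> int) k :
  (forall i, (i <= k + k)%N -> F (k + k - i)%N = F i) ->
  \sum_(i < (k + k).+1) F i = F k + 2%:R * \sum_(i < k) F i.
Proof.
move=> h; rewrite -(big_mkord xpredT F) -(big_mkord xpredT F).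
rewrite (@big_cat_nat _ _ _ k) ?leqW ?leq_addr //=.
rewrite [X in _ + X]big_ltn ?ltnS ?leq_addr //.
suff -> : \sum_(k.+1 <= i < (k + k).+1) F i = \sum_(0 <= i < k) F i by ring.
rewrite big_nat_rev /= -{1}[k.+1]add0n big_addn (_ : (k + k).+1 - k.+1 = k)%N; last by lia.
rewrite !big_nat; apply: eq_bigr => i hi; rewrite -(h i); last by lia.
by congr F; lia.
Qed.

Lemma sum_sym_odd (F : nat -> int) k :
  (forall i, (i <= (k + k).+1)%N -> F ((k + k).+1 - i)%N = F i) ->
  \sum_(i < (k + k).+2) F i = 2%:R * \sum_(i < k.+1) F i.
Proof.
move=> h; rewrite -(big_mkord xpredT F) -(big_mkord xpredT F).
rewrite (@big_cat_nat _ _ _ k.+1) //=; last by lia.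
suff -> : \sum_(k.+1 <= i < (k + k).+2) F i = \sum_(0 <= i < k.+1) F i by ring.
rewrite big_nat_rev /= -{1}[k.+1]add0n big_addn (_ : (k + k).+2 - k.+1 = k.+1)%N; last by lia.
rewrite !big_nat; apply: eq_bigr => i hi; rewrite -(h i); last by lia.
by congr F; lia.
Qed.

Section OneGraph.
Variables (n : nat) (A : 'M[int]_n).
Hypothesis hA : adjacency A.
Let c k := (pdet A)`_k.
Let v k := (psum A)`_k.

Lemma coef_sqr_even k :
  (4 %| c k ^+ 2 + 2%:R * \sum_(i < k) c i * c (k + k - i)%N - (n.+1%:R * c k - v k))%Z.
Proof.
have [q /(congr1 (fun p : {poly int} => p`_(k + k)))] := pdet_sqr_mod4 hA.
rewrite expr2 coefM (@sum_sym_even (fun i => c i * c (k + k - i)%N)); last first.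
  by move=> i hi; rewrite mulrC; congr (c _ * _); lia.
rewrite addnK -expr2 => ->.
rewrite !(coefD, coefN, mulr_natl, coefMn) !coef_comp_poly_Xn // addnn -muln2 dvdn_mull // mulnK //.
rewrite addrAC subrr; lia.
Qed.

(** At an odd exponent the polynomials composed with ['X^2] contribute nothing, and the folded sum
    appears twice, so divisibility by 4 is halved. *)
Lemma coef_sqr_odd k :
  (2 %| \sum_(i < k.+1) c i * c ((k + k).+1 - i)%N)%Z.
Proof.
have [q /(congr1 (fun p : {poly int} => p`_((k + k).+1)))] := pdet_sqr_mod4 hA.
rewrite expr2 coefM (@sum_sym_odd (fun i => c i * c ((k + k).+1 - i)%N)); last first.
  by move=> i hi; rewrite mulrC; congr (c _ * _); lia.
rewrite !(coefD, coefN, mulr_natl, coefMn) !coef_comp_poly_Xn //.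
have -> : (2 %| (k + k).+1)%N = false by apply/negbTE; lia.
rewrite ?mul0rn; set S := \sum_(i < _) _ => h; lia.
Qed.

Lemma coef_odd_even k : (2 %| c (k + k).+1)%Z.
Proof.
elim/ltn_ind: k => k IH.
have := coef_sqr_odd k; rewrite big_ord_recl subn0 /= {1}/c coef0_pdet mul1r.
rewrite rpredDr //; apply: rpred_sum => i _; rewrite /bump /= add1n subSS.
(* The two indices add up to an odd number, so one of them is odd; it is smaller than [(k + k).+1]
   and the induction hypothesis covers it. *)
have [j [hj|hj]] : exists j, (i.+1 = (j + j).+1 \/ k + k - i = (j + j).+1)%N.
- by exists (if odd i then ((k + k - i).-1)./2 else i./2); case: ifP; have := ltn_ord i; lia.
- by rewrite hj dvdz_mulr // IH //; have := ltn_ord i; lia.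
- by rewrite hj dvdz_mull // IH //; have := ltn_ord i; lia.
Qed.

(** Reduction of [coef_sqr_even] modulo 2, where [c k ^+ 2] and [c k] agree. *)
Lemma psum_parity k : (2 %| v k - n%:R * c k)%Z.
Proof.
have := coef_sqr_even k.
have [x [->|->]] : exists x : int, c k = 2%:R * x \/ c k = 2%:R * x + 1.
- by exists (c k %/ 2)%Z; lia.
- rewrite -[n.+1]addn1 natrD. set S := \sum_(_ < _) _. nia.
- rewrite -[n.+1]addn1 natrD; set S := \sum_(_ < _) _. nia.
Qed.
End OneGraph.

(* [bcoef A k] is the [b_(k+1)] of the header: indices are shifted by one. *)
Definition bcoef n (A : 'M[int]_n) k := 2%:R * (pdet A)`_k.+1 - (psum A)`_k.

Lemma bcoef_parity_even n (A : 'M[int]_n) k : adjacency A -> ~~ odd n ->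
  (2 %| bcoef A k)%Z.
Proof.
move=> hA on; have := psum_parity hA k; rewrite /bcoef.
have [m ->] : exists m, n%:R = 2%:R * m :> int by exists (n./2)%:R; lia.
by rewrite -mulrA; set y := m * _; lia.
Qed.

Lemma bcoef_parity_odd n (A : 'M[int]_n) k : adjacency A -> odd n ->
  (2 %| bcoef A k - (pdet A)`_k)%Z.
Proof.
move=> hA on; have := psum_parity hA k; rewrite /bcoef.
have [m ->] : exists m, n%:R = 2%:R * m + 1 :> int by exists (n./2)%:R; lia.
by rewrite mulrDl -mulrA mul1r; set y := m * _; lia.
Qed.

Lemma sqr_mod4 (x y : int) : (2 %| x - y)%Z -> (4 %| x ^+ 2 - y ^+ 2)%Z.
Proof.
move=> h; have [d ->] : exists d, x = y + 2%:R * d by exists ((x - y) %/ 2)%Z; lia.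
by rewrite (_ : _ - _ = 4%:R * (d * y + d ^+ 2)); [rewrite dvdz_mulr | ring].
Qed.

Lemma mod2_transport (a b x y : int) : (2 %| a - x)%Z -> (2 %| b - y)%Z ->
  (2 %| x - y)%Z = (2 %| a - b)%Z.
Proof. lia. Qed.

Lemma mod4_weaken (a b : int) : (4 %| a - b)%Z -> (2 %| a - b)%Z.
Proof. lia. Qed.

(** Used with [N = n + 1], [a = c_l], [b = c_(2l)], [S] the remaining cross terms, [t = c_(l+1)] and
    [v = v_l]. Every term except [2 b] agrees modulo 4 on both sides, so [b] agrees modulo 2. *)
Lemma mod4_solve (N a a' b b' S S' t t' v v' : int) : (2 %| N)%Z ->
  (4 %| a ^+ 2 + 2%:R * (b + S) - (N * a - v))%Z ->
  (4 %| a' ^+ 2 + 2%:R * (b' + S') - (N * a' - v'))%Z ->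
  (4 %| (2%:R * t - v) - (2%:R * t' - v'))%Z ->
  (2 %| a - a')%Z -> (2 %| t - t')%Z -> (2 %| S - S')%Z -> (2 %| b - b')%Z.
Proof.
move=> hN e e' ev ha ht hS; have h := sqr_mod4 ha.
have h5 : (4 %| N * a - N * a')%Z.
  rewrite -mulrBr.
  have [x ->] : exists x, N = 2%:R * x by exists (N %/ 2)%Z; clear -hN; lia.
  have [y ->] : exists y, a - a' = 2%:R * y by exists ((a - a') %/ 2)%Z; clear -ha; lia.
  by rewrite (_ : 2%:R * x * (2%:R * y) = 4%:R * (x * y)); [rewrite dvdz_mulr | ring].
move: e e' h h5; set p := a ^+ 2; set p' := a' ^+ 2; set r := N * a; set r' := N * a'.
lia.
Qed.

Lemma bcoef_determined n (A B : 'M[int]_n) m : adjacency A -> adjacency B ->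
  odd n -> (3 <= m)%N ->
  (forall j, (j < m)%N -> (4 %| bcoef A j - bcoef B j)%Z) ->
  (2 %| bcoef A m - bcoef B m)%Z.
Proof.
move=> hA hB on m3 hb.
have tr k := mod2_transport (bcoef_parity_odd k hA on) (bcoef_parity_odd k hB on).
rewrite -tr.
have hc j : (j < m)%N -> (2 %| (pdet A)`_j - (pdet B)`_j)%Z.
  by move=> /hb /mod4_weaken; rewrite tr.
have [k [hk|hk]] : exists k, (m = (k + k).+1 \/ m = k + k)%N.
- by exists m./2; clear; lia.
- by rewrite hk rpredB ?coef_odd_even.
(* Here [m = k + k] with [m] at least 3, so [k] is at least 2. This gives [l.+1 < m], so that
   [c_(l+1)] is among the coefficients already controlled. *)
case: k hk => [|[|k]] hk; rewrite ?hk // in m3 *; set l := k.+2 in hk *.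
have ltm x : (x <= l.+1)%N -> (x < m)%N by rewrite hk /l; clear; lia.
have eA := coef_sqr_even hA l; have eB := coef_sqr_even hB l.
rewrite big_ord_recl subn0 coef0_pdet mul1r in eA.
rewrite big_ord_recl subn0 coef0_pdet mul1r in eB.
apply: (mod4_solve _ eA eB (hb l (ltm _ _))).
- by move: on; clear; lia.
- exact: leqnSn.
- exact: hc (ltm _ (leqnSn _)).
- exact: hc (ltm _ (leqnn _)).
rewrite -sumrB; apply: rpred_sum => i _.
set x := lift _ _.
have hx : (0 < x < l)%N by rewrite /x /= /bump /= add1n ltnS ltn_ord.
have h1 : (2 %| (pdet A)`_x - (pdet B)`_x)%Z.
  by apply: hc; apply: ltm; move: hx; clear; lia.
have h2 : (2 %| (pdet A)`_(l + l - x) - (pdet B)`_(l + l - x))%Z.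
  by apply: hc; rewrite hk; move: hx; clear; lia.
rewrite (_ : _ - _ = ((pdet A)`_x - (pdet B)`_x) * (pdet A)`_(l + l - x) +
    (pdet B)`_x * ((pdet A)`_(l + l - x) - (pdet B)`_(l + l - x))); last by ring.
by apply: rpredD; [apply: dvdz_mulr | apply: dvdz_mull].
Qed.

End Parity.

(** * Paths *)

Section Gadgets.

Definition root_row k : 'rV[int]_k := \row_j ((j : nat) == 0%N)%:R.

(** Each new vertex is joined to vertex 0 of the shorter path and becomes the new vertex 0, so the
    border row is always [root_row]; on no vertices that row is empty and needs no special case. *)
Fixpoint path_mx k : 'M[int]_k :=
  if k is k'.+1 then
    block_mx (0 : 'M_1) (root_row k') (root_row k')^T (path_mx k') : 'M_(1 + k')
  else 0.

Lemma path_adjacency k : adjacency (path_mx k).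
Proof.
elim: k => [|k IH]; first by split=> [i|i|i]; case: i.
by apply: adjacency_of_border => // j; rewrite mxE; case: (_ == _); [right | left].
Qed.

Notation P k := (pdet (path_mx k)).
Notation V k := (psum (path_mx k)).
Definition path_rt k : {poly int} :=
  quadf (map_mx polyC (root_row k)) (pencil (path_mx k)) (const_mx 1).
Definition path_rr k : {poly int} :=
  quadf (map_mx polyC (root_row k)) (pencil (path_mx k)) (map_mx polyC (root_row k))^T.

Lemma root_rowE k : map_mx polyC (root_row k) =
  \row_j ((j : nat) == 0%N)%:R :> 'rV[{poly int}]_k.
Proof. by apply/matrixP=> i j; rewrite !mxE; case: (_ == _). Qed.

Lemma path_rrS k : path_rr k.+1 = P k.
Proof.
have [As _ _] := path_adjacency k.
rewrite /path_rr root_rowE /= (pencil_border (path_mx k)) quadf_root ?pdet_neq0 //.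
by rewrite -pencil_border pdet_neq0.
Qed.

Lemma path_rtS k : path_rt k.+1 = P k - 'X * path_rt k.
Proof.
have [As _ _] := path_adjacency k.
rewrite /path_rt root_rowE /= (pencil_border (path_mx k)) quadf_root_ones ?pdet_neq0 //.
  by rewrite quadf_scale.
by rewrite -pencil_border pdet_neq0.
Qed.

Lemma path_PS k : P k.+1 = P k - 'X^2 * path_rr k.
Proof. exact: pdet_border. Qed.

Lemma path_VS k : V k.+1 * P k = V k * P k.+1 + path_rt k.+1 ^+ 2.
Proof. by have [As _ _] := path_adjacency k; rewrite path_rtS; apply: psum_border. Qed.

Lemma path_rr0 : path_rr 0 = 0.
Proof. by rewrite /path_rr /quadf mxE big_ord0. Qed.

Lemma path_rt0 : path_rt 0 = 0.
Proof. by rewrite /path_rt /quadf mxE big_ord0. Qed.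

Lemma path_P0 : P 0 = 1. Proof. exact: pdet_mx00. Qed.

Lemma path_P1 : P 1 = 1.
Proof. by rewrite path_PS path_P0 path_rr0; ring. Qed.

Lemma path_PSS k : P k.+2 = P k.+1 - 'X^2 * P k.
Proof. by rewrite path_PS path_rrS. Qed.

(** Cassini's identity for the recurrence [path_PSS]: each step multiplies the left side by
    ['X^2]. *)
Lemma path_cassini k : P k.+2 * P k - P k.+1 ^+ 2 = - ((- 'X) ^+ k.+1) ^+ 2.
Proof.
elim: k => [|k IH]; first by rewrite path_PSS path_P1 path_P0; ring.
have -> : ((- 'X) ^+ k.+2) ^+ 2 = 'X^2 * ((- 'X) ^+ k.+1) ^+ 2 :> {poly int}.
  by rewrite [(- 'X) ^+ k.+2]exprS; ring.
rewrite -[RHS]mulrN -IH [P k.+3]path_PSS [P k.+2]path_PSS; ring.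
Qed.

(** Solution of the recurrence [path_rtS]: [P k.+1 + 'X * P k] is a particular solution after
    scaling by [1 + 2 y], and the powers of [- 'X] solve the homogeneous equation. *)
Lemma path_rtE k :
  (1 + 2%:R * 'X) * path_rt k.+1 = P k.+1 + 'X * P k - (- 'X) ^+ k.+1.
Proof.
elim: k => [|k IH]; first by rewrite path_rtS path_rt0 path_P1 path_P0; ring.
rewrite path_rtS mulrBr mulrCA IH [P k.+2]path_PSS [(- 'X) ^+ k.+2]exprS; ring.
Qed.

Lemma const_decomp (p : {poly int}) : exists q, p = (p`_0)%:P + 'X * q.
Proof.
elim/poly_ind: p => [|p c _]; first by exists 0; rewrite coef0 mulr0 addr0.
by exists p; rewrite coefD coefMX coefC /= add0r addrC mulrC.
Qed.

Lemma cancel_unit_const (q d z : {poly int}) m : q`_0 = 1 ->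
  q * d = (- 'X) ^+ m * z -> exists2 b, d = (- 'X) ^+ m * b & q * b = z.
Proof.
move=> q0; elim: m d => [|m IH] d h.
  by exists d; rewrite ?mul1r // h mul1r.
have [d1 hd] := const_decomp d.
have d0 : d`_0 = 0.
  by have := congr1 (fun p : {poly int} => p`_0) h;
     rewrite coef0M q0 mul1r exprS !mulNr -?mulrA ?mulNr coefN coefXM oppr0.
have X0 : (- 'X : {poly int}) != 0 by rewrite oppr_eq0 polyX_eq0.
have [|b hb1 hb2] := IH (- d1).
  by apply: (mulfI X0); rewrite [RHS]mulrA -exprS -h hd d0; ring.
by exists b; rewrite // hd d0 exprS -mulrA -hb1; ring.
Qed.

(** The left side is the difference of the [V] parts when two paths on [k.+1] vertices are replaced
    by paths on [k.+2] and [k]. Its leading coefficient 2 comes from the cross term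
    [2 P k.+2 P k.+1] in the squares of [path_rtE]. *)
Lemma path_second_difference k : exists b,
  V k.+2 * P k + P k.+2 * V k - 2%:R * V k.+1 * P k.+1
  = (- 'X) ^+ k.+1 * (2%:R + 'X * b).
Proof.
set d := _ - _.
(* The factor [P k.+1] allows [path_VS] to be applied, and the square of [1 + 2 y] brings in
   [path_rtE]. The constant coefficient of [q] is 1, so [q] is cancelled at the end. *)
pose q := P k.+1 * (1 + 2%:R * 'X) ^+ 2.
have q0 : q`_0 = 1.
  by rewrite /q coef0M coef0_pdet mul1r expr2 coef0M !coefD coef1 mulr_natl coefMn coefX.
have Pe j : exists g, P j = 1 + 'X * g.
  by have [g ->] := const_decomp (P j); exists g; rewrite coef0_pdet.
have [g0 h0] := Pe k; have [g1 h1] := Pe k.+1; have [g2 h2] := Pe k.+2.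
pose eta : {poly int} := (- 'X) ^+ k.+1.
have etaE : eta = - 'X * (- 'X) ^+ k by rewrite /eta exprS.
have hd : exists b, q * d = eta * (2%:R + 'X * b).
  (* The terms in [eta ^+ 2] are absorbed by writing one factor [eta] as [- 'X * (- 'X) ^+ k]; they
     form the last two lines. *)
  exists (2%:R * (g1 + g2 + 'X * g1 * g2)
     + 2%:R * P k * (P k.+2 + 'X * P k.+1) + 2%:R * P k.+2 * P k
     + (- 'X) ^+ k * (2%:R * (1 + 2%:R * 'X) ^+ 2 * V k.+1
       + 2%:R * P k.+2 - 2%:R * 'X^2 * P k)).
  have -> : q * d = (1 + 2%:R * 'X) ^+ 2 * 2%:R * V k.+1 * (P k.+2 * P k - P k.+1 ^+ 2)
     + P k * ((1 + 2%:R * 'X) * path_rt k.+2) ^+ 2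
     - P k.+2 * ((1 + 2%:R * 'X) * path_rt k.+1) ^+ 2.
    have e1 : V k.+2 * P k.+1 = V k.+1 * P k.+2 + path_rt k.+2 ^+ 2 := path_VS k.+1.
    have e2 : path_rt k.+1 ^+ 2 = V k.+1 * P k - V k * P k.+1 by rewrite path_VS; ring.
    have e3 : path_rt k.+2 ^+ 2 = V k.+2 * P k.+1 - V k.+1 * P k.+2 by rewrite e1; ring.
    by rewrite !exprMn e2 e3 /q /d; ring.
  rewrite path_cassini !path_rtE -/eta.
  have -> : (- 'X) ^+ k.+2 = - 'X * eta :> {poly int} by rewrite exprS.
  rewrite -[X in X = _]addrA.
  have -> : P k * (P k.+2 + 'X * P k.+1 - - 'X * eta) ^+ 2 -
            P k.+2 * (P k.+1 + 'X * P k - eta) ^+ 2 =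
     (P k.+2 * P k - P k.+1 ^+ 2) * (P k.+2 - 'X^2 * P k)
     + eta * (2%:R * P k.+2 * P k.+1
              + 'X * (2%:R * P k * (P k.+2 + 'X * P k.+1) + 2%:R * P k.+2 * P k))
     + eta ^+ 2 * ('X^2 * P k - P k.+2) by ring.
  rewrite path_cassini -/eta.
  have -> : 2%:R * P k.+2 * P k.+1 = 2%:R + 'X * (2%:R * (g1 + g2 + 'X * g1 * g2)).
    by rewrite h1 h2; ring.
  by rewrite !expr2 {2 4 6}etaE; ring.
have [b /(cancel_unit_const q0) [z -> hz]] := hd.
have [z1 hz1] := const_decomp z; exists z1.
have z0 : z`_0 = 2.
  have := congr1 (fun p : {poly int} => p`_0) hz.
  by rewrite coef0M q0 mul1r coefD coefXM addr0 -polyC_natr coefC.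
by rewrite hz1 z0 polyC_natr.
Qed.

End Gadgets.

(** * Disjoint unions *)

Section Pairs.
Notation cvpair := ({poly int} * {poly int})%type.
Implicit Types x y z : cvpair.

Definition graph_pair n (A : 'M[int]_n) : cvpair := (pdet A, psum A).

(* Multiplication of [C + eps V] in the dual numbers. *)
Definition pmul x y : cvpair := (x.1 * y.1, x.2 * y.1 + x.1 * y.2).
Definition pone : cvpair := (1, 0).
Definition ppow x m := iter m (pmul x) pone.

Lemma pmulA x y z : pmul x (pmul y z) = pmul (pmul x y) z.
Proof. by rewrite /pmul /=; congr pair; ring. Qed.

Lemma pmul1 x : pmul pone x = x.
Proof. by case: x => a b; rewrite /pmul /=; congr pair; ring. Qed.

Lemma ppowD x m k : pmul (ppow x m) (ppow x k) = ppow x (m + k).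
Proof. by elim: m => [|m IH]; rewrite ?pmul1 //= -pmulA IH. Qed.

Definition realizable n x : Prop := exists2 A : 'M[int]_n, adjacency A & graph_pair A = x.

Lemma realizable_mul n m x y :
  realizable n x -> realizable m y -> realizable (n + m) (pmul x y).
Proof.
case=> A hA <- [B hB <-]; exists (block_mx A 0 0 B); first exact: adjacency_dsum.
by rewrite /graph_pair pdet_dsum psum_dsum.
Qed.

Lemma realizable_one : realizable 0 pone.
Proof.
exists 0; first by split=> [i|i|i]; case: i.
by rewrite /graph_pair pdet_mx00 psum_mx00.
Qed.

Lemma realizable_pow n x m : realizable n x -> realizable (m * n) (ppow x m).
Proof.
move=> h; elim: m => [|m IH]; first exact: realizable_one.
by rewrite mulSn; apply: realizable_mul.
Qed.

Definition ppath k := graph_pair (path_mx k).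

Lemma realizable_path k : realizable k (ppath k).
Proof. by exists (path_mx k) => //; apply: path_adjacency. Qed.

Definition unital x := exists g, x.1 = 1 + 'X * g.

Lemma unital_graph n (A : 'M[int]_n) : unital (graph_pair A).
Proof.
by rewrite /unital /=; have [g ->] := const_decomp (pdet A); exists g; rewrite coef0_pdet.
Qed.

Lemma unital_mul x y : unital x -> unital y -> unital (pmul x y).
Proof.
by move=> [g hg] [h hh]; exists (g + h + 'X * g * h); rewrite /= hg hh; ring.
Qed.

Lemma unital_one : unital pone.
Proof. by exists 0; rewrite /=; ring. Qed.

Lemma unital_pow x m : unital x -> unital (ppow x m).
Proof. by move=> h; elim: m => [|m IH]; [apply: unital_one | apply: unital_mul]. Qed.

(* Passing from [y] to [x] changes [b_(k+2)] by [2 t] up to sign and no earlier [b_j]. *)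
Definition differ k (t : int) x y : Prop :=
  [/\ unital x, unital y
    & exists a b, x.1 = y.1 + (- 'X) ^+ k.+1 * 'X^2 * a /\
                  x.2 = y.2 + (- 'X) ^+ k.+1 * ((2%:R * t)%:P + 'X * b)].

Lemma differ_refl k x : unital x -> differ k 0 x x.
Proof. by move=> h; split=> //; exists 0, 0; rewrite mulr0 polyC0; split; ring. Qed.

Lemma differ_sym k t x y : differ k t x y -> differ k (- t) y x.
Proof.
case=> hx hy [a [b [h1 h2]]]; split=> //; exists (- a), (- b).
by rewrite h1 h2 [2%:R * - t]mulrN polyCN; split; ring.
Qed.

Lemma differ_trans k t s x y z :
  differ k t x y -> differ k s y z -> differ k (t + s) x z.
Proof.
case=> hx hy [a [b [h1 h2]]] [_ hz [c [d [h3 h4]]]]; split=> //; exists (a + c), (b + d).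
by rewrite h1 h2 h3 h4 [2%:R * (t + s)]mulrDr polyCD; split; ring.
Qed.

(** Each leading deviation is multiplied by a determinant part with constant term 1, so the leading
    terms add. Deviations of the determinant parts carry an extra ['X^2] and only reach higher
    terms. *)
Lemma differ_mul k t s x y x' y' :
  differ k t x y -> differ k s x' y' -> differ k (t + s) (pmul x x') (pmul y y').
Proof.
case=> hx hy [a [b [h1 h2]]] [hx' hy' [c [d [h3 h4]]]].
split; [exact: unital_mul | exact: unital_mul |].
have [g hg] := hy; have [g' hg'] := hy'.
exists (a * y'.1 + y.1 * c + (- 'X) ^+ k.+1 * 'X^2 * a * c).
pose E : {poly int} := (- 'X) ^+ k.+1.
exists (b * y'.1 + (2%:R * t)%:P * g' + d * y.1 + (2%:R * s)%:P * g
  + ((2%:R * t)%:P + 'X * b) * E * 'X * c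
  + y.2 * 'X * c + 'X * a * x'.2).
rewrite /= -/E; split; first by rewrite h1 h3 -/E; ring.
rewrite h1 h2 h3 -/E [2%:R * (t + s)]mulrDr polyCD.
have -> : (y.1 + E * 'X^2 * a) * x'.2 =
   y.1 * y'.2 + y.1 * (E * ((2%:R * s)%:P + 'X * d)) + E * 'X^2 * a * x'.2.
  by rewrite h4 -/E; ring.
have -> : y.1 * (E * ((2%:R * s)%:P + 'X * d)) =
   E * ((2%:R * s)%:P + 'X * ((2%:R * s)%:P * g + d * y.1)).
  by rewrite hg; ring.
have -> : (y.2 + E * ((2%:R * t)%:P + 'X * b)) * (y'.1 + E * 'X^2 * c) =
   y.2 * y'.1 + E * ((2%:R * t)%:P + 'X * (b * y'.1 + (2%:R * t)%:P * g'))
   + y.2 * E * 'X^2 * c + E * ((2%:R * t)%:P + 'X * b) * E * 'X^2 * c.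
  by rewrite hg'; ring.
ring.
Qed.

Lemma differ_lower k j t x y : (j < k)%N -> differ k t x y -> differ j 0 x y.
Proof.
move=> jk [hx hy [a [b [h1 h2]]]]; split=> //.
have E : (- 'X) ^+ k.+1 = (- 'X) ^+ j.+1 * (- 'X) * (- 'X) ^+ (k - j).-1 :> {poly int}.
  by rewrite -exprSr -exprD; congr (_ ^+ _); lia.
exists (- 'X * (- 'X) ^+ (k - j).-1 * a), (- (- 'X) ^+ (k - j).-1 * ((2%:R * t)%:P + 'X * b)).
by rewrite h1 h2 E mulr0 polyC0; split; ring.
Qed.

(* Both have [2 k + 2] vertices; [k] stands for the [i - 2] of the header. *)
Definition gadget k := pmul (ppath k.+2) (ppath k).
Definition gadget' k := pmul (ppath k.+1) (ppath k.+1).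

Lemma gadget_differ k : (0 < k)%N -> differ k 1 (gadget k) (gadget' k).
Proof.
case: k => // k _; split; try by apply: unital_mul; apply: unital_graph.
have [b hb] := path_second_difference k.+1.
(* By [path_cassini] the determinant parts differ by a pure power of ['X]; a positive index makes it
   divisible by the power that [differ] requires. *)
exists (- (- 'X) ^+ k), b; rewrite /=; split.
  have := path_cassini k.+1; move/(canRL (subrK _)) => ->.
  by rewrite expr2 [((- 'X) ^+ k.+2)]exprS exprS; ring.
by rewrite mulr1 polyC_natr -hb; ring.
Qed.

Lemma differ_pow k t x y m : differ k t x y -> differ k (t * m%:R) (ppow x m) (ppow y m).
Proof.
move=> h; elim: m => [|m IH]; first by rewrite mulr0; apply: differ_refl; apply: unital_one.
by rewrite -[m.+1]add1n natrD mulrDr mulr1; apply: differ_mul.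
Qed.

(** Always [K] blocks of equal size, so for [t] at most [K] the number of vertices does not depend
    on [t]. *)
Definition mixed K t k := pmul (ppow (gadget k) t) (ppow (gadget' k) (K - t)).

Lemma unital_gadget k : unital (gadget k) /\ unital (gadget' k).
Proof. by split; apply: unital_mul; apply: unital_graph. Qed.

Lemma mixed_differ K t s k : (0 < k)%N -> (t <= K)%N -> (s <= K)%N ->
  differ k (t%:R - s%:R) (mixed K t k) (mixed K s k).
Proof.
move=> k0 tK sK.
have h m : (m <= K)%N -> differ k m%:R (mixed K m k) (ppow (gadget' k) K).
  move=> mK; rewrite -[in ppow _ K](subnKC mK) -ppowD -[m%:R]addr0; apply: differ_mul.
    by rewrite -[m%:R]mul1r; apply: differ_pow; apply: gadget_differ.
  by apply: differ_refl; apply: unital_pow; case: (unital_gadget k).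
exact: differ_trans (h t tK) (differ_sym (h s sK)).
Qed.

Lemma realizable_mixed K t k : (t <= K)%N ->
  realizable (K * (k.+1 + k.+1)) (mixed K t k).
Proof.
move=> tK; rewrite -{1}(subnKC tK) mulnDl; apply: realizable_mul; apply: realizable_pow.
  by rewrite -addSnnS; apply: realizable_mul; apply: realizable_path.
by apply: realizable_mul; apply: realizable_path.
Qed.

Fixpoint tower K (t : nat -> nat) m : cvpair :=
  if m is m'.+1 then pmul (tower K t m') (mixed K (t m) m) else pone.

Fixpoint tower_size K m : nat :=
  if m is m'.+1 then (tower_size K m' + K * (m.+1 + m.+1))%N else 0%N.

Lemma realizable_tower K t m : (forall k, (t k <= K)%N) ->
  realizable (tower_size K m) (tower K t m).
Proof.
move=> tK; elim: m => [|m IH]; first exact: realizable_one.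
by apply: realizable_mul => //; apply: realizable_mixed.
Qed.

Lemma unital_tower K t m : unital (tower K t m).
Proof.
elim: m => [|m IH]; first exact: unital_one.
by apply: unital_mul => //; apply: unital_mul; apply: unital_pow; case: (unital_gadget m.+1).
Qed.

Lemma tower_ext K t s m : (forall j, (0 < j <= m)%N -> t j = s j) ->
  tower K t m = tower K s m.
Proof.
elim: m => [//|m IH] h /=; rewrite IH => [|j hj]; last by apply: h; lia.
by rewrite h //=.
Qed.

Lemma tower_differ K t s m k : (0 < k <= m)%N ->
  (forall j, (t j <= K)%N) -> (forall j, (s j <= K)%N) ->
  (forall j, (0 < j < k)%N -> t j = s j) ->
  differ k ((t k)%:R - (s k)%:R) (tower K t m) (tower K s m).
Proof.
move=> /andP[k0 km] tK sK h; elim: m km => [|m IH]; first by lia.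
rewrite leq_eqVlt => /orP[/eqP ek|km].
  rewrite ek in h *; rewrite /= (@tower_ext K t s m) // -[_ - _]add0r.
  by apply: differ_mul; [apply/differ_refl/unital_tower | apply: mixed_differ].
rewrite -[_ - _]addr0; apply: differ_mul; first exact: IH.
(* The factor at level [m.+1] lies above [k], so its deviation is invisible there, whatever the
   multiplicities. *)
by apply: differ_lower km (@mixed_differ K _ _ _ _ _ _).
Qed.

End Pairs.

(** * Sign matrices as adjacency matrices, and the first coefficients *)

Section SignMatrices.

Lemma symSign1_adjacency n (M : 'M[int]_n) : symSign1 M ->
  exists2 A, adjacency A & M = const_mx 1 - 2%:R *: A.
Proof.
case=> Ms M1 Md; exists (\matrix_(i, j) (M i j == -1)%:R).
  split=> [i j|i|i j]; rewrite !mxE; first by rewrite Ms.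
    by rewrite Md.
  by case: (_ == _); [right | left].
by apply/matrixP=> i j; rewrite !mxE; case: (M1 i j) => ->.
Qed.

Lemma adjacency_symSign1 n (A : 'M[int]_n) : adjacency A ->
  symSign1 (const_mx 1 - 2%:R *: A).
Proof.
case=> As A0 A1; split=> [i j|i j|i]; rewrite !mxE; first by rewrite As.
  by case: (A1 i j) => ->; [left | right].
by rewrite A0.
Qed.

Lemma bcoef0 n (A : 'M[int]_n) : adjacency A -> bcoef A 0 = - n%:R.
Proof.
case/low_coefs => a [p [q [hC hV]]]; rewrite /bcoef hC hV.
rewrite !coefD coef1 -[_ * a * 'X]mulrC coefXM !coefXnM /= -polyC_natr coefC /=; ring.
Qed.

Lemma coef0_psum n (A : 'M[int]_n) : adjacency A -> (psum A)`_0 = n%:R.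
Proof.
case/low_coefs => a [p [q [_ hV]]]; rewrite hV.
rewrite !coefD -[_ * a * 'X]mulrC coefXM !coefXnM /= -polyC_natr coefC /=; ring.
Qed.

Lemma bcoef1 n (A : 'M[int]_n) : adjacency A -> bcoef A 1 = 0.
Proof.
case/low_coefs => a [p [q [hC hV]]]; rewrite /bcoef hC hV.
rewrite !coefD coef1 -[_ * a * 'X]mulrC coefXM !coefXnM /= -polyC_natr coefC /=.
have -> : (2%:R * a)`_0 = 2%:R * a`_0 by rewrite mulr_natl coefMn mulr_natl.
by rewrite coefD coefXM /=; ring.
Qed.

End SignMatrices.

(** * The family of graphs for the lower bound *)

Section LowerFamily.

Definition pbcoef (x : {poly int} * {poly int}) k : int := 2%:R * x.1`_k.+1 - x.2`_k.

Lemma pbcoefE x k : pbcoef x k = (2%:R * x.1 - 'X * x.2)`_k.+1.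
Proof. by rewrite /pbcoef coefB coefXM [2%:R * x.1]mulr_natl coefMn /=; ring. Qed.

Lemma pbcoef_differ k t x y : differ k t x y ->
  (forall i, (i <= k)%N -> pbcoef x i = pbcoef y i) /\
  pbcoef x k.+1 - pbcoef y k.+1 = (-1) ^+ k * (2%:R * t).
Proof.
case=> _ _ [a [b [h1 h2]]].
have h : 2%:R * x.1 - 'X * x.2 = 2%:R * y.1 - 'X * y.2
   + (-1) ^+ k * ('X^(k.+2) * ((2%:R * t)%:P + 'X * (b - 2%:R * a))).
  have E : (- 'X) ^+ k.+1 = - ((-1) ^+ k * 'X^(k.+1)) :> {poly int}.
    by rewrite [LHS]exprNn exprS mulN1r mulNr.
  have E2 : 'X^(k.+2) = 'X * 'X^(k.+1) :> {poly int} by rewrite exprS.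
  by rewrite h1 h2 E E2; set S := (-1) ^+ k; ring.
have cs (p : {poly int}) i : ((-1) ^+ k * p)`_i = (-1) ^+ k * p`_i.
  by rewrite -[in LHS]signr_odd -[in RHS]signr_odd !mulr_sign; case: (odd k); rewrite ?coefN.
split=> [i hi|].
  by rewrite !pbcoefE h coefD cs coefXnM !ltnS hi mulr0 addr0.
rewrite !pbcoefE h coefD cs coefXnM ltnn subnn addrC addKr.
by rewrite coefD coefC coefXM /= addr0.
Qed.

Variables (K m f : nat).

(* The optional edge, the gadgets, and [f] isolated vertices. *)
Definition start (s : bool) := if s then ppath 2 else pmul (ppath 1) (ppath 1).
Definition rest t := pmul (tower K t m) (ppow (ppath 1) f).
Definition full s t := pmul (start s) (rest t).

Lemma realizable_rest t : (forall k, (t k <= K)%N) ->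
  realizable (tower_size K m + f) (rest t).
Proof.
move=> tK; apply: realizable_mul; first exact: realizable_tower.
by have := @realizable_pow 1 _ f (realizable_path 1); rewrite muln1.
Qed.

Lemma realizable_full s t : (forall k, (t k <= K)%N) ->
  realizable (2 + (tower_size K m + f)) (full s t).
Proof.
move=> tK; apply: realizable_mul; last exact: realizable_rest.
rewrite /start; case: s; first exact: realizable_path.
by apply: (@realizable_mul 1 1); apply: realizable_path.
Qed.

Lemma unital_start s : unital (start s).
Proof. by case: s; rewrite /start; try apply: unital_mul; apply: unital_graph. Qed.

Lemma full_differ s t t' k : (0 < k <= m)%N ->
  (forall j, (t j <= K)%N) -> (forall j, (t' j <= K)%N) ->
  (forall j, (0 < j < k)%N -> t j = t' j) ->
  differ k ((t k)%:R - (t' k)%:R) (full s t) (full s t').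
Proof.
move=> hk tK tK' h.
rewrite -[_ - _]add0r; apply: differ_mul; first exact/differ_refl/unital_start.
rewrite -[_ - _]addr0; apply: differ_mul; first exact: tower_differ.
by apply/differ_refl/unital_pow/unital_graph.
Qed.

Lemma ppath1 : ppath 1 = (1, 1).
Proof.
rewrite /ppath /graph_pair path_P1; congr pair.
by have := path_VS 0; rewrite path_P0 path_P1 path_rtS path_rt0 path_P0 psum_mx00 => h;
   rewrite -[LHS]mulr1 h; ring.
Qed.

Lemma ppath2 : ppath 2 = (1 - 'X^2, 2%:R - 2%:R * 'X).
Proof.
have [e] := ppath1; rewrite /ppath /graph_pair path_PSS path_P1 path_P0 => h1.
congr pair; first by rewrite mulr1.
have := path_VS 1; rewrite path_PSS path_P0 path_P1 !path_rtS path_rt0 path_P0 path_P1 h1 => h.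
by rewrite -[LHS]mulr1 h; ring.
Qed.

(** The edge and the two isolated vertices give values of [2 C - y V] that differ by [y^3] times the
    [V] of the rest, whose constant coefficient counts the remaining vertices. *)
Lemma full_flag t : (forall k, (t k <= K)%N) ->
  pbcoef (full true t) 2 - pbcoef (full false t) 2 = (tower_size K m + f)%:R.
Proof.
move=> tK; rewrite /full /= !pbcoefE ppath2 ppath1 -coefB.
have [A hA hr] := realizable_rest tK.
rewrite -(coef0_psum hA) -[psum A]/(graph_pair A).2 hr; case: (rest t) => c v /=.
rewrite (_ : _ - _ = 'X^3 * v) ?coefXnM //=; ring.
Qed.

End LowerFamily.

(** * Counting *)

Section Counting.

Lemma pow2_cancel (k e : nat) (z : int) : (k <= e)%N ->
  (2%:R ^+ e %| 2%:R ^+ k * z)%Z = (2%:R ^+ (e - k) %| z)%Z.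
Proof.
by move=> ke; rewrite -{1}(subnKC ke) exprD dvdz_mul2l ?expf_neq0.
Qed.

Lemma pow2_dvd (k e : nat) (z : int) : (k <= e)%N ->
  (2%:R ^+ e %| z)%Z -> (2%:R ^+ k %| z)%Z.
Proof. by move=> ke; apply: dvdz_trans; rewrite -(subnKC ke) exprD dvdz_mulr. Qed.

Lemma small_cong (N a b : nat) : (a < N)%N -> (b < N)%N ->
  (N%:Z %| a%:R - b%:R)%Z -> a = b.
Proof.
by move=> aN bN; rewrite -eqz_mod_dvd !natz !modz_nat !modn_small // => /eqP[].
Qed.

Lemma pow2E l : (2%:R : int) ^+ l = (2 ^ l)%N%:Z.
Proof. by rewrite -natrX natz. Qed.

Lemma full_flag_even K m f s t t' : (0 < m)%N ->
  (forall j, (t j <= K)%N) -> (forall j, (t' j <= K)%N) ->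
  (2 %| pbcoef (full K m f s t) 2 - pbcoef (full K m f s t') 2)%Z.
Proof.
move=> m0 tK tK'.
have d := @full_differ K m f s t t' 1 m0 tK tK' (fun j h => ltac:(lia)).
by have [_ ->] := pbcoef_differ d; rewrite mulrCA dvdz_mulr.
Qed.

Lemma full_flag_odd K m f t t' : (0 < m)%N -> odd (tower_size K m + f) ->
  (forall j, (t j <= K)%N) -> (forall j, (t' j <= K)%N) ->
  ~~ (2 %| pbcoef (full K m f true t) 2 - pbcoef (full K m f false t') 2)%Z.
Proof.
move=> m0 on tK tK'.
have := full_flag_even f false m0 tK tK'; have := full_flag m f tK.
move: on; clear; lia.
Qed.

(** The parity at index 2 reveals the flag. Once the multiplicities below [j] agree, the entry at
    [j.+1] changes by [2 (t j - t' j)] up to sign; with the weight [2 ^ j.+1] this shows [t j]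
    modulo [2 ^ (m - j)], enough by the bound on [t j]. *)
Lemma full_separated e' f s s' t t' (K := (2 ^ e'.+3)%N) (m := e'.+1) :
  (s == s') || odd (tower_size K m + f) ->
  (forall j, (t j <= K)%N) -> (forall j, (t' j <= K)%N) ->
  (forall j, (0 < j <= m)%N -> (t j < 2 ^ (m - j))%N) ->
  (forall j, (0 < j <= m)%N -> (t' j < 2 ^ (m - j))%N) ->
  (forall k, (2 <= k < e'.+3)%N -> (2%:R ^+ e'.+3 %|
      2%:R ^+ k * (pbcoef (full K m f s t) k - pbcoef (full K m f s' t') k))%Z) ->
  s = s' /\ forall j, (0 < j <= m)%N -> t j = t' j.
Proof.
move=> hs tK tK' tb tb' h.
have m0 : (0 < m)%N by [].
have es : s = s'.
  have := h 2%N isT; rewrite pow2_cancel // => /(@pow2_dvd 1 (e'.+3 - 2) _ isT).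
  rewrite expr1; case: eqP hs => //= ne on.
  move: ne; clear h; case: s; case: s' => // _ h2.
    by have := full_flag_odd m0 on tK tK'; rewrite h2.
  by have := full_flag_odd m0 on tK' tK; rewrite -opprB rpredN h2.
split=> //; rewrite -{}es in h *.
elim/ltn_ind => j IH hj.
have d := full_differ f s hj tK tK' (fun i hi => IH i (ltac:(lia)) (ltac:(lia))).
have hk : (2 <= j.+1 < e'.+3)%N by move: hj; rewrite /m; lia.
have := h j.+1 hk.
have [_ ->] := pbcoef_differ d.
have ej : (e'.+3 - j.+1 = (m - j).+1)%N by move: hj; rewrite /m; lia.
rewrite pow2_cancel ?ej; last by move: hk; lia.
rewrite -signr_odd mulr_sign (fun_if (fun z => z \in dvdz _)) rpredN if_same.
rewrite -[2%:R in X in (_ %| X)%Z]expr1 pow2_cancel // subSS subn0 pow2E.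
by apply: small_cong; [apply: tb | apply: tb'].
Qed.

End Counting.

(** * Reconstructing residues from parities and quotients *)

Section Residues.

Lemma val_intr_Zp (N : nat) (x : int) : (1 < N)%N ->
  ((x%:~R : 'Z_N) : nat)%:Z = (x %% N%:Z)%Z.
Proof.
move=> N1.
have [r hr] : exists r : nat, (x %% N%:Z)%Z = r%:Z.
  by exists `|(x %% N%:Z)%Z|%N; rewrite gez0_abs // modz_ge0 // eqz_nat -lt0n ltnW.
have rN : (r < N)%N by rewrite -ltz_nat -hr ltz_pmod // ltz_nat ltnW.
rewrite {1}(divz_eq x N%:Z) hr intrD intrM.
rewrite -[N%:Z%:~R]/(N%:R) -[r%:Z%:~R]/(r%:R).
have -> : N%:R = 0 :> 'Z_N by apply: val_inj; rewrite /= val_Zp_nat // modnn.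
by rewrite mulr0 add0r val_Zp_nat // modn_small.
Qed.

Lemma eq_intr_Zp (N : nat) (x y : int) : (1 < N)%N ->
  (x%:~R = y%:~R :> 'Z_N) <-> (N%:Z %| x - y)%Z.
Proof.
move=> N1; rewrite -eqz_mod_dvd -!val_intr_Zp //.
by split=> [->//|/eqP[h]]; apply: val_inj.
Qed.

Lemma pow2_gt1 e : (0 < e)%N -> (1 < 2 ^ e)%N.
Proof. by move=> h; rewrite -{1}(expn0 2) ltn_exp2l. Qed.

Lemma residue_cong e i (z : int) : (0 < e)%N -> (i <= e)%N ->
  (2%:R ^+ i %| ((z%:~R : 'Z_(2 ^ e)) : nat)%:Z - z)%Z.
Proof.
move=> e0 ie; apply: (pow2_dvd ie); rewrite val_intr_Zp ?pow2_gt1 // pow2E.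
by rewrite -eqz_mod_dvd modz_mod.
Qed.

(** For [b] the coefficient [b_3] of the header, this reads its parity off the residue of
    [a_3 = 4 b_3]. *)
Lemma residue_mod8 e (b : int) : (3 <= e)%N ->
  (((2%:R ^+ 2 * b)%:~R : 'Z_(2 ^ e)) %% 8 == 0)%N = (2 %| b)%Z.
Proof.
move=> e3; have := residue_cong (2%:R ^+ 2 * b) (ltnW (ltnW e3)) e3.
rewrite pow2E (_ : 2%:R ^+ 2 * b = 4%:R * b); last by ring.
by set X := nat_of_ord _; clearbody X; clear; lia.
Qed.

Lemma residue_eq e i (x y : int) : (0 < e)%N -> (i <= e)%N ->
  (2%:R ^+ i %| x - y)%Z ->
  ((x%:~R : 'Z_(2 ^ e)) %/ 2 ^ i = (y%:~R : 'Z_(2 ^ e)) %/ 2 ^ i)%N ->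
  x%:~R = y%:~R :> 'Z_(2 ^ e).
Proof.
move=> e0 ie h hq; apply: val_inj => /=.
set X := nat_of_ord _ in hq *; set Y := nat_of_ord _ in hq *.
have rX := fun z => residue_cong z e0 ie.
have hm : X = Y %[mod 2 ^ i].
  apply/eqP; have : (2%:R ^+ i %| X%:Z - Y%:Z)%Z.
    rewrite (_ : X%:Z - Y%:Z = (X%:Z - x) + (x - y) - (Y%:Z - y)); last by ring.
    by apply: rpredB; [apply: rpredD => //; apply: rX | apply: rX].
  by rewrite pow2E -eqz_mod_dvd !modz_nat.
by rewrite (divn_eq X (2 ^ i)) (divn_eq Y (2 ^ i)) hq hm.
Qed.

Lemma char_coef_bcoef n (A : 'M[int]_n) k : (k < n)%N ->
  char_coef (const_mx 1 - 2%:R *: A) k.+1 = 2%:R ^+ k * bcoef A k.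
Proof. exact: char_coefE. Qed.

(** The first hypothesis upgrades a parity to a full residue; the induction supplies the parities.
    Indices 0 and 1 are constants, even [n] forces even values, index 2 is assumed for odd [n], and
    [bcoef_determined] does the rest. *)
Lemma bcoefs_determined n e (A B : 'M[int]_n) : adjacency A -> adjacency B ->
  (forall k, (2 <= k < e)%N -> (2 %| bcoef A k - bcoef B k)%Z ->
     (2%:R ^+ e %| 2%:R ^+ k * (bcoef A k - bcoef B k))%Z) ->
  (odd n -> (2 %| bcoef A 2 - bcoef B 2)%Z) ->
  forall k, (k < e)%N -> (2%:R ^+ e %| 2%:R ^+ k * (bcoef A k - bcoef B k))%Z.
Proof.
move=> hA hB hs hf; elim/ltn_ind => -[|[|k]] IH hk.
- by rewrite !bcoef0 // subrr mulr0 dvdz0.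
- by rewrite !bcoef1 // subrr mulr0 dvdz0.
apply: hs; first by rewrite hk.
case on : (odd n); last by rewrite rpredB // bcoef_parity_even ?on.
case: k hk IH => [|k] hk IH.
  exact: hf.
apply: bcoef_determined => // j hj.
have := IH j hj (ltn_trans hj hk).
rewrite pow2_cancel; last by move: hj hk; clear; lia.
(* From [j < k.+3 < e] follows [e - j >= 2], so the residue of the weighted coefficient fixes the
   coefficient modulo 4. *)
by apply: (@pow2_dvd 2); move: hj hk; clear; lia.
Qed.

Lemma residues_determined n e (M M' : 'M[int]_n) : (3 <= e)%N -> (e <= n)%N ->
  symSign1 M -> symSign1 M' ->
  (forall i, (3 <= i <= e)%N ->
    ((char_coef M i)%:~R : 'Z_(2 ^ e)) %/ 2 ^ i ==
    ((char_coef M' i)%:~R : 'Z_(2 ^ e)) %/ 2 ^ i)%N ->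
  (odd n -> (((char_coef M 3)%:~R : 'Z_(2 ^ e)) %% 8 == 0)%N ==
            (((char_coef M' 3)%:~R : 'Z_(2 ^ e)) %% 8 == 0)%N) ->
  forall i, (2 <= i <= e)%N ->
    (char_coef M i)%:~R = (char_coef M' i)%:~R :> 'Z_(2 ^ e).
Proof.
move=> e3 en /symSign1_adjacency[A hA ->] /symSign1_adjacency[B hB ->] hq hf.
have e0 : (0 < e)%N := ltnW (ltnW e3).
have n2 : (2 < n)%N := leq_trans e3 en.
case=> [|k] /andP[k1 hk]; first by exfalso; move: k1; clear.
have kn := leq_trans hk en.
rewrite (char_coef_bcoef A kn) (char_coef_bcoef B kn).
apply/(eq_intr_Zp _ _ (pow2_gt1 e0)); rewrite -pow2E -mulrBr.
apply: (bcoefs_determined hA hB) => [j /andP[j2 je] h2|on|]; last exact: hk.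
  have jn := leq_trans je en.
  rewrite mulrBr pow2E; apply/(eq_intr_Zp _ _ (pow2_gt1 e0)).
  (* Equal parities make the coefficients with weight [2 ^ j] agree modulo [2 ^ j.+1]; the recorded
     quotient supplies the higher bits. *)
  apply: (@residue_eq e j.+1 _ _ e0 je).
    by rewrite -mulrBr exprSr dvdz_mul2l // expf_neq0.
  have := hq j.+1; rewrite (char_coef_bcoef A jn) (char_coef_bcoef B jn).
  by rewrite ltnS j2 je => /(_ isT) /eqP.
have h8 := hf on; rewrite (char_coef_bcoef A n2) (char_coef_bcoef B n2) in h8.
have : (2 %| bcoef A 2)%Z = (2 %| bcoef B 2)%Z.
  exact: etrans (esym (residue_mod8 _ e3)) (etrans (eqP h8) (residue_mod8 _ e3)).
by move: (bcoef A 2) (bcoef B 2); clear => x y; lia.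
Qed.

End Residues.

(** * Codes for the tuples of residues *)

Section Codes.

Lemma card_ord_lt (N m : nat) : (m <= N)%N -> #|[pred x : 'I_N | (x < m)%N]| = m.
Proof.
move=> h; rewrite -sum1_card -[RHS]card_ord -[in RHS]sum1_card.
by rewrite (big_ord_widen_cond N xpredT (fun=> 1%N)) //.
Qed.

Variable d : nat.
Local Notation e := d.+3.

(** The same set serves both bounds: as quotients of the residues of [a_(i+3)] by [2 ^ (i+3)], and
    as gadget multiplicities at level [i + 1]. The codomain is merely a common finite type. *)
Definition codes : {set {ffun 'I_d.+1 -> 'I_(2 ^ e).+1}} :=
  [set g in family (fun i : 'I_d.+1 => [pred x : 'I_(2 ^ e).+1 | (x < 2 ^ (d - i))%N])].

Lemma card_codes : #|codes| = (2 ^ 'C(e - 2, 2))%N.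
Proof.
rewrite cardsE card_family foldrE big_map big_enum /=.
rewrite (eq_bigr (fun i : 'I_d.+1 => 2 ^ (d - i))%N) => [|i _]; last first.
  rewrite card_ord_lt // ltnW // ltnS leq_exp2l //; lia.
rewrite -expn_sum; congr (_ ^ _)%N.
rewrite (reindex_inj rev_ord_inj) /= -bin2_sum big_mkord.
by apply: eq_bigr => i _; rewrite subSS subKn // -ltnS ltn_ord.
Qed.

(** Entry [i] of the tuple is [a_(i+2)]; [lift ord0] skips the entry [a_2], which is always 0. *)
Definition quotients (t : (e.-1).-tuple 'Z_(2 ^ e)) : {ffun 'I_d.+1 -> 'I_(2 ^ e).+1} :=
  [ffun i => inord ((tnth t (lift ord0 i) : nat) %/ 2 ^ i.+3)].

Definition code (t : (e.-1).-tuple 'Z_(2 ^ e)) :=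
  (((tnth t (lift ord0 ord0) : nat) %% 8 == 0)%N, quotients t).

Lemma ltn_Zp2 (x : 'Z_(2 ^ e)) : (x < 2 ^ e)%N.
Proof. by have := ltn_ord x; rewrite [X in (_ < X)%N]Zp_cast // pow2_gt1. Qed.

Lemma quotient_lt (x : 'Z_(2 ^ e)) i : (i <= d)%N -> (x %/ 2 ^ i.+3 < 2 ^ (d - i))%N.
Proof.
move=> id; rewrite ltn_divLR ?expn_gt0 // -expnD.
by rewrite (_ : d - i + i.+3 = e)%N ?ltn_Zp2 //; lia.
Qed.

Lemma val_quotients t i : quotients t i = ((tnth t (lift ord0 i) : nat) %/ 2 ^ i.+3)%N :> nat.
Proof. by rewrite ffunE inordK // ltnS (leq_trans (leq_div _ _)) // ltnW // ltn_Zp2. Qed.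

Lemma quotients_codes t : quotients t \in codes.
Proof.
rewrite inE; apply/familyP => i; rewrite inE val_quotients quotient_lt //.
by rewrite -ltnS ltn_ord.
Qed.

End Codes.

(** * The upper and the lower bound *)

Section Bounds.
Variables (d n : nat).
Local Notation e := d.+3.
Local Notation classes := (char_classes e (@symSign1 n)).

Lemma classesP t :
  reflect (exists2 M : 'M[int]_n, symSign1 M & char_residues e M = t) (t \in classes).
Proof. by rewrite inE; apply: asboolP. Qed.

Lemma tnth_residues (M : 'M[int]_n) i :
  tnth (char_residues e M) i = (char_coef M i.+2)%:~R.
Proof. exact: tnth_mktuple. Qed.

Lemma val_quotients_residues (M : 'M[int]_n) (i : 'I_d.+1) :
  quotients (char_residues e M) i =
  (((char_coef M i.+3)%:~R : 'Z_(2 ^ e)) %/ 2 ^ i.+3)%N :> nat.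
Proof. by rewrite val_quotients tnth_residues. Qed.

Lemma quotients_inj t t' : (e <= n)%N -> t \in classes -> t' \in classes ->
  quotients t == quotients t' -> (odd n -> (code t).1 == (code t').1) -> t = t'.
Proof.
move=> en /classesP[M hM <-] /classesP[M' hM' <-] hq hf.
apply: eq_from_tnth => i; rewrite !tnth_residues.
apply: (residues_determined (isT : (3 <= e)%N) en hM hM').
- case=> [|[|[|j]]] /andP[j3 hj]; try by exfalso; move: j3; clear.
  pose i0 := Ordinal (hj : (j < d.+1)%N).
  apply/eqP; apply: etrans (esym (val_quotients_residues M i0)) _.
  by apply: etrans (val_quotients_residues M' i0); rewrite (eqP hq).
- by move=> on; have := hf on; rewrite /code /= !tnth_residues.
- by rewrite /= ltnS ltn_ord.
Qed.

Lemma card_classes_leq : (e <= n)%N ->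
  (#|classes| <= (if odd n then 2 else 1) * 2 ^ 'C(e - 2, 2))%N.
Proof.
move=> en; case on: (odd n).
  have inj : {in classes &, injective (@code d)}.
    move=> t t' ht ht' h; apply: (quotients_inj en ht ht'); last by rewrite h.
    by apply/eqP; have := congr1 snd h.
  have -> : (2 * 2 ^ 'C(e - 2, 2) = #|finset.setX [set: bool] (codes d)|)%N.
    by rewrite cardsX cardsT card_bool card_codes.
  rewrite -(card_in_imset inj).
  apply: subset_leq_card; apply/fintype.subsetP => _ /imsetP[t _ ->].
  by apply/finset.setXP; split; [rewrite finset.in_setT | apply: quotients_codes].
have inj : {in classes &, injective (@quotients d)}.
  by move=> t t' ht ht' h; apply: (quotients_inj en ht ht'); rewrite ?h ?on.
rewrite -(card_in_imset inj) mul1n -(card_codes d).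
apply: subset_leq_card; apply/fintype.subsetP => _ /imsetP[t _ ->].
exact: quotients_codes.
Qed.

Variable f : nat.
Hypothesis en : (e <= n)%N.
Hypothesis nE : n = (2 + (tower_size (2 ^ e) d.+1 + f))%N.

Definition multiplicity (g : {ffun 'I_d.+1 -> 'I_(2 ^ e).+1}) (j : nat) : nat := g (inord j.-1).

Lemma multiplicity_le g j : (multiplicity g j <= 2 ^ e)%N.
Proof. by rewrite -ltnS ltn_ord. Qed.

Lemma multiplicity_lt g j : g \in codes d -> (0 < j <= d.+1)%N ->
  (multiplicity g j < 2 ^ (d.+1 - j))%N.
Proof.
rewrite inE => /familyP h hj; have := h (inord j.-1).
rewrite inE /multiplicity; set x := nat_of_ord _; rewrite inordK; last by lia.
by rewrite (_ : d - j.-1 = d.+1 - j)%N //; lia.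
Qed.

Lemma class_of_code (sg : bool * {ffun 'I_d.+1 -> 'I_(2 ^ e).+1}) :
  exists t, t \in classes /\ forall i, tnth t i =
    (2%:R ^+ i.+1 * pbcoef (full (2 ^ e) d.+1 f sg.1 (multiplicity sg.2)) i.+1)%:~R.
Proof.
have [] := @realizable_full (2 ^ e) d.+1 f sg.1 _ (multiplicity_le sg.2).
rewrite -nE => A hA hr.
exists (char_residues e (const_mx 1 - 2%:R *: A)); split.
  by apply/classesP; exists (const_mx 1 - 2%:R *: A) => //; apply: adjacency_symSign1.
move=> i; rewrite tnth_residues char_coefE; first by rewrite -hr.
by apply: leq_trans en; rewrite ltnS ltn_ord.
Qed.

Lemma card_classes_geq :
  ((if odd n then 2 else 1) * 2 ^ 'C(e - 2, 2) <= #|classes|)%N.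
Proof.
have [H hH] := choice class_of_code.
(* For even [n] the flag is fixed, since it cannot be recovered from a parity. *)
pose D := finset.setX (if odd n then [set: bool] else [set false]) (codes d).
have -> : ((if odd n then 2 else 1) * 2 ^ 'C(e - 2, 2) = #|D|)%N.
  by rewrite cardsX card_codes; case: (odd n); rewrite ?cardsT ?card_bool ?cards1.
have inj : {in D &, injective H}.
  move=> [s g] [s' g'] /finset.setXP[hs hg] /finset.setXP[hs' hg'] eH.
  have [||||||es et] := @full_separated d f s s' (multiplicity g) (multiplicity g').
  (* The optional edge and its replacement both use two vertices, so the rest has the parity of
     [n]. *)
  - case on: (odd n) hs hs'; rewrite nE /= negbK in on.
      by rewrite on orbT.
    by rewrite !inE => /eqP-> /eqP->.
  - exact: multiplicity_le.
  - exact: multiplicity_le.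
  - by move=> j; apply: multiplicity_lt.
  - by move=> j; apply: multiplicity_lt.
  - case=> [//|k] /andP[_ hk].
    have [_ h1] := hH (s, g); have [_ h2] := hH (s', g').
    pose i0 : 'I_e.-1 := Ordinal (hk : (k < e.-1)%N).
    have := etrans (esym (h1 i0)) (etrans (congr1 (fun t => tnth t i0) eH) (h2 i0)).
    by move/(eq_intr_Zp _ _ (pow2_gt1 (isT : (0 < e)%N))); rewrite -mulrBr -pow2E.
  rewrite es; congr pair; apply/ffunP => i; apply: val_inj.
  have := et i.+1; rewrite /multiplicity /= inord_val; apply; exact: ltn_ord.
rewrite -(card_in_imset inj); apply: subset_leq_card.
by apply/fintype.subsetP => _ /imsetP[x _ ->]; case: (hH x).
Qed.

End Bounds.

Local Close Scope ring_scope.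

Theorem theorem1p3 (e : nat) (he : 3 <= e) :
  exists N : nat, forall n : nat, N < n ->
    #|char_classes e (@symSign1 n)| =
      if odd n then 2 ^ ('C(e - 2, 2) + 1) else 2 ^ 'C(e - 2, 2).
Proof.
case: e he => [|[|[|d]]] // _.
(* Beyond this bound all coefficients up to [a_e] have index at most [n], and the construction fits,
   with the remaining vertices left isolated. *)
exists (maxn d.+3 (2 + tower_size (2 ^ d.+3) d.+1)) => n.
rewrite gtn_max => /andP[/ltnW en /ltnW Nn].
have -> : (if odd n then 2 ^ ('C(d.+3 - 2, 2) + 1) else 2 ^ 'C(d.+3 - 2, 2)) =
  (if odd n then 2 else 1) * 2 ^ 'C(d.+3 - 2, 2).
  by case: (odd n); rewrite ?addn1 ?expnS ?mul1n.
apply/eqP; rewrite eqn_leq card_classes_leq //=.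
by apply: (@card_classes_geq d n (n - (2 + tower_size (2 ^ d.+3) d.+1))) => //; lia.
Qed.
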